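(* With $F^{(n)}_i$ the matrix-coefficient functions on $U^-$ defined in the context, the following hold, for arbitrary complex parameters $a_{k,j}$, $\bar a_{k,j}$ (independent variables; the bar does not mean complex conjugation). (i) Type $A_n$. For $y=(y_n(a_{1,n})\cdots y_1(a_{1,1}))(y_n(a_{2,n})\cdots y_2(a_{2,2}))\cdots(y_n(a_{n-1,n})y_{n-1}(a_{n-1,n-1}))\,y_n(a_{n,n})$ and $1\le i\le n$, $$F^{(n)}_i(y)=\prod_{k=1}^{i}\prod_{j=k}^{n-i+k}a_{k,j}.$$ (ii) Type $B_n$. For $$y=(y_1(a_{1,1})\cdots y_n(a_{1,n})y_{n-1}(\bar a_{1,n-1})\cdots y_1(\bar a_{1,1}))(y_2(a_{2,2})\cdots y_n(a_{2,n})\cdots y_2(\bar a_{2,2}))\cdots(y_{n-1}(a_{n-1,n-1})y_n(a_{n-1,n})y_{n-1}(\bar a_{n-1,n-1}))\,y_n(a_{n,n}),$$ $$F^{(n)}_i(y)=\begin{cases}\displaystyle\prod_{1\le k\le i\le j\le n}a_{k,j}\bar a_{k,j}\prod_{1\le k\le j<i}\bar a_{k,j}^2&\text{if }i<n,\\[2mm]\displaystyle\prod_{1\le k\le j\le n}\bar a_{k,j}&\text{if }i=n,\end{cases}$$ where $\bar a_{k,n}:=a_{k,n}$. (iii) Type $C_n$. For $y$ given by the same formula as in (ii) and $1\le i\le n$, $$F^{(n)}_i(y)=\prod_{1\le k\le i\le j\le n}a_{k,j}\prod_{1\le k\le i\le j<n}\bar a_{k,j}\prod_{1\le k\le j<i}\bar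 a_{k,j}^2,$$ where for $i=n$ the second factor is understood to be $1$. (iv) Type $D_n$. For $$y=(y_1(a_{1,1})\cdots y_{n-1}(a_{1,n-1})y_n(\bar a_{1,n-1})y_{n-2}(\bar a_{1,n-2})\cdots y_1(\bar a_{1,1}))\cdots(y_{n-2}(a_{n-2,n-2})y_{n-1}(a_{n-2,n-1})y_n(\bar a_{n-2,n-1})y_{n-2}(\bar a_{n-2,n-2}))(y_{n-1}(a_{n-1,n-1})y_n(\bar a_{n-1,n-1})),$$ (the $k$-th bracket, $1\le k\le n-2$, being $y_k(a_{k,k})\cdots y_{n-1}(a_{k,n-1})y_n(\bar a_{k,n-1})y_{n-2}(\bar a_{k,n-2})\cdots y_k(\bar a_{k,k})$), $$F^{(n)}_i(y)=\begin{cases}\displaystyle\prod_{1\le k\le i\le j<n}a_{k,j}\bar a_{k,j}\prod_{1\le k\le j<i}\bar a_{k,j}^2&\text{if }1\le i\le n-2,\\[2mm] \displaystyle\Bigl(\prod_{1\le k\le j<n-1}\bar a_{k,j}\Bigr)(a_{1,n-1}\bar a_{2,n-1}\cdots a_{n-1,n-1})&\text{if }i=n-1,\ n\text{ even},\\[2mm] \displaystyle\Bigl(\prod_{1\le k\le j<n-1}\bar a_{k,j}\Bigr)(\bar a_{1,n-1}a_{2,n-1}\cdots a_{n-1,n-1})&\text{if }i=n-1,\ n\text{ odd},\\[2mm] \displaystyle\Bigl(\prod_{1\le k\le j<n-1}\bar a_{k,j}\Bigr)(a_{1,n-1}\bar a_{2,n-1}\cdots\bar a_{n-1,n-1})&\text{if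 }i=n,\ n\text{ odd},\\[2mm] \displaystyle\Bigl(\prod_{1\le k\le j<n-1}\bar a_{k,j}\Bigr)(\bar a_{1,n-1}a_{2,n-1}\cdots\bar a_{n-1,n-1})&\text{if }i=n,\ n\text{ even},\end{cases}$$ where in the last four cases the factors in the second parenthesis are alternately unbarred and barred: one factor with index $(k,n-1)$ for each $k=1,\dots,n-1$.
   Context: Let $\mathfrak g$ be the simple complex Lie algebra of the indicated type with index set $I=\{1,\dots,n\}$, Chevalley generators $e_i,f_i$, simple coroots $h_i$, simple roots $\alpha_i$, and Cartan matrix $\mathbf a_{ij}=\alpha_j(h_i)$. For $A_n$ the numbering is the standard one. For $B_n$: $\mathbf a_{ii}=2$, $\mathbf a_{ij}=-1$ if $|i-j|=1$ and $(i,j)\ne(n,n-1)$, $\mathbf a_{n,n-1}=-2$, else $0$ ($\alpha_n$ short). For $C_n$: $\mathbf a_{ii}=2$, $\mathbf a_{ij}=-1$ if $|i-j|=1$ and $(i,j)\ne(n-1,n)$, $\mathbf a_{n-1,n}=-2$, else $0$ ($\alpha_n$ long). For $D_n$: $\mathbf a_{ii}=2$, $\mathbf a_{ij}=-1$ if $|i-j|=1$ and $\{i,j\}\ne\{n-1,n\}$ or if $\{i,j\}=\{n-2,n\}$, else $0$. $G$ is the corresponding simply connected algebraic group, $U^-$ the maximal unipotent subgroup generated by the negative root subgroups, $y_i(t)=\exp(tf_i)\in U^-$. Fundamental weights $\Lambda_i$ satisfy $\Lambda_i(h_j)=\delta_{ij}$; $L(\Lambda_i)$ is the irreducible module with fixed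 highest weight vector $u_{\Lambda_i}$. On $L(\Lambda_i)$ let $\langle\ ,\ \rangle$ be the symmetric bilinear form with $\langle u_{\Lambda_i},u_{\Lambda_i}\rangle=1$ and $\langle gu,v\rangle=\langle u,\hat\omega(g)v\rangle$, where $\hat\omega$ is the anti-involution of $U(\mathfrak g)$ with $\hat\omega(e_j)=f_j$, $\hat\omega(f_j)=e_j$, $\hat\omega(h)=h$ for $h$ in the Cartan subalgebra. Let $v_{\Lambda_i}\in L(\Lambda_i)$ be the lowest weight vector with $\langle v_{\Lambda_i},v_{\Lambda_i}\rangle=1$ given by $v_{\Lambda_i}=f_{j_1}^{(m_1)}\cdots f_{j_N}^{(m_N)}u_{\Lambda_i}$, where $j_1\cdots j_N$ is a reduced word of the longest Weyl group element, $f^{(m)}=f^m/m!$ and $m_k=(s_{j_{k+1}}\cdots s_{j_N}\Lambda_i)(h_{j_k})$ (this does not depend on the reduced word). Define $$F^{(n)}_i(u)=\langle u\cdot u_{\Lambda_i},v_{\Lambda_i}\rangle\qquad(u\in U^-,\ i\in I).$$ *)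

(* Defs.v *)
From HB Require Import structures.
From mathcomp Require Import all_boot all_order all_algebra.

Set Implicit Arguments.
Unset Strict Implicit.
Unset Printing Implicit Defensive.

Import Order.TTheory GRing.Theory Num.Theory.
Local Open Scope ring_scope.

(** * Lie algebras and their finite-dimensional modules *)

Record lieAlgebra (K : fieldType) := LieAlgebra {
  lie_vect :> vectType K;
  bracket : lie_vect -> lie_vect -> lie_vect;
  bracket_linl : forall (c : K) x y z,
    bracket (c *: x + y) z = c *: bracket x z + bracket y z;
  bracket_linr : forall (c : K) x y z,
    bracket z (c *: x + y) = c *: bracket z x + bracket z y;
  bracketxx : forall x, bracket x x = 0;
  jacobi : forall x y z,
    bracket x (bracket y z) + bracket y (bracket z x)
      + bracket z (bracket x y) = 0 }.

Arguments bracket {K l}.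

Definition lie_ideal (K : fieldType) (g : lieAlgebra K) (W : {vspace g}) :=
  forall x y : g, y \in W -> bracket x y \in W.

Definition lie_simple (K : fieldType) (g : lieAlgebra K) :=
  (exists x y : g, bracket x y != 0) /\
  (forall W : {vspace g}, lie_ideal W -> W = 0%VS \/ W = fullv).

Record lieModule (K : fieldType) (g : lieAlgebra K) := LieModule {
  mod_vect :> vectType K;
  act : g -> 'End(mod_vect);
  act_lin : forall (c : K) x y, act (c *: x + y) = c *: act x + act y;
  act_bracket : forall x y,
    act (bracket x y) = (act x \o act y)%VF - (act y \o act x)%VF }.

Arguments act {K g}.

Definition lie_irreducible (K : fieldType) (g : lieAlgebra K)
    (V : lieModule g) :=
  (exists v : V, v != 0) /\
  (forall W : {vspace V},
     (forall (x : g) (v : V), v \in W -> act V x v \in W) ->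
     W = 0%VS \/ W = fullv).

(** * Cartan matrices *)

Inductive dynkin := TypeA | TypeB | TypeC | TypeD.

(* [i] and [j] are numbered from 1 to [n] here. *)
Definition cartan_entry (ty : dynkin) (n i j : nat) : int :=
  let adj := (i == j.+1) || (j == i.+1) in
  if i == j then 2 else
  match ty with
  | TypeA => if adj then -1 else 0
  | TypeB => if (i == n) && (j.+1 == n) then -2 else if adj then -1 else 0
  | TypeC => if (i.+1 == n) && (j == n) then -2 else if adj then -1 else 0
  | TypeD =>
      let last_two := ((i.+1 == n) && (j == n)) || ((i == n) && (j.+1 == n)) in
      let fork := ((i.+2 == n) && (j == n)) || ((i == n) && (j.+2 == n)) in
      if (adj && ~~ last_two) || fork then -1 else 0
  end.

(* The ordinal [i : 'I_n] stands for the node i + 1 of the Dynkin diagram. *)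
Definition cartan (ty : dynkin) (n : nat) : 'M[int]_n :=
  \matrix_(i, j) cartan_entry ty n i.+1 j.+1.

(* The entry [A i j] is alpha_j(h_i). *)
Record chevalley (K : fieldType) (n : nat) (A : 'M[int]_n) (g : lieAlgebra K) :=
  Chevalley {
  che : 'I_n -> g;
  chf : 'I_n -> g;
  chh : 'I_n -> g;
  chev_hh : forall i j, bracket (chh i) (chh j) = 0;
  chev_he : forall i j, bracket (chh i) (che j) = (A i j)%:~R *: che j;
  chev_hf : forall i j, bracket (chh i) (chf j) = - ((A i j)%:~R *: chf j);
  chev_ef : forall i j,
    bracket (che i) (chf j) = if i == j then chh i else 0;
  chev_serre_e : forall i j, i != j ->
    iter `|1 - A i j|%N (bracket (che i)) (che j) = 0;
  chev_serre_f : forall i j, i != j ->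
    iter `|1 - A i j|%N (bracket (chf i)) (chf j) = 0;
  chev_gen : forall W : {vspace g},
    (forall x y : g, x \in W -> y \in W -> bracket x y \in W) ->
    (forall i, che i \in W) -> (forall i, chf i \in W) -> W = fullv }.

(** * Weights and the Weyl group *)

(* An integral weight is given by its values on the simple coroots. *)
Definition weight (n : nat) := {ffun 'I_n -> int}.

Definition fund_weight (n : nat) (i : 'I_n) : weight n :=
  [ffun j => (i == j)%:Z].

Definition simple_refl (n : nat) (A : 'M[int]_n) (j : 'I_n) (l : weight n) :
    weight n :=
  [ffun k => l k - l j * A k j].

(* The product s_{j_1} ... s_{j_N}; the Weyl group acts faithfully on
   weights. *)
Definition weyl_act (n : nat) (A : 'M[int]_n) (w : seq 'I_n) (l : weight n) :
    weight n :=
  foldr (simple_refl A) l w.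

Definition reduced_word (n : nat) (A : 'M[int]_n) (w : seq 'I_n) :=
  forall w' : seq 'I_n, weyl_act A w' =1 weyl_act A w -> (size w <= size w')%N.

Definition longest_word (n : nat) (A : 'M[int]_n) (w : seq 'I_n) :=
  reduced_word A w /\
  (forall w' : seq 'I_n, reduced_word A w' -> (size w' <= size w)%N).

(** * Fundamental modules *)

Inductive chev_letter (n : nat) :=
  | LetE of 'I_n | LetF of 'I_n | LetH of 'I_n.

Definition omega_letter (n : nat) (x : chev_letter n) : chev_letter n :=
  match x with
  | LetE i => LetF i
  | LetF i => LetE i
  | LetH i => LetH i
  end.

(* Words in the generators span U(g), so an anti-automorphism of U(g) is
   determined by its values on them. *)
Definition omega_hat (n : nat) (w : seq (chev_letter n)) :=
  rev (map (@omega_letter n) w).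

Section Modules.
Variables (K : fieldType) (n : nat) (A : 'M[int]_n) (g : lieAlgebra K).
Variable C : chevalley A g.

Definition letter_elt (x : chev_letter n) : g :=
  match x with
  | LetE i => che C i
  | LetF i => chf C i
  | LetH i => chh C i
  end.

Definition act_word (V : lieModule g) (w : seq (chev_letter n)) (v : V) : V :=
  foldr (fun x => act V (letter_elt x)) v w.

(* The module L(Lambda_i), with its highest weight vector and its
   contravariant form. *)
Record fundModule (i : 'I_n) := FundModule {
  fm_mod :> lieModule g;
  fm_irr : lie_irreducible fm_mod;
  fm_u : fm_mod;
  fm_u_neq0 : fm_u != 0;
  fm_u_e : forall j, act fm_mod (che C j) fm_u = 0;
  fm_u_h : forall j,
    act fm_mod (chh C j) fm_u = (fund_weight i j)%:~R *: fm_u;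
  fm_form : fm_mod -> fm_mod -> K;
  fm_form_lin : forall (c : K) x y z,
    fm_form (c *: x + y) z = c * fm_form x z + fm_form y z;
  fm_form_sym : forall x y, fm_form x y = fm_form y x;
  fm_form_u : fm_form fm_u fm_u = 1;
  fm_form_omega : forall (w : seq (chev_letter n)) x y,
    fm_form (act_word w x) y = fm_form x (act_word (omega_hat w) y) }.

End Modules.

(** * Divided powers and exponentials of operators *)

Definition lfun_pow (K : fieldType) (V : vectType K) (f : 'End(V)) (m : nat) :
    'End(V) :=
  iter m (fun p => (f \o p)%VF) \1%VF.

Definition div_pow (K : fieldType) (V : vectType K) (f : 'End(V)) (m : nat) :
    'End(V) :=
  (m`!%:R)^-1 *: lfun_pow f m.

(* Only used for nilpotent operators, for which all the powers above the
   dimension vanish. *)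
Definition nil_exp (K : fieldType) (V : vectType K) (f : 'End(V)) : 'End(V) :=
  \sum_(m < (\dim {:V}).+1) div_pow f m.

(** * The group U^- and the functions F_i *)

Record setting (K : fieldType) (n : nat) (A : 'M[int]_n) := Setting {
  st_g : lieAlgebra K;
  st_simple : lie_simple st_g;
  st_chev : chevalley A st_g;
  st_L : forall i : 'I_n, fundModule st_chev i }.

Section Group.
Variables (K : fieldType) (n : nat) (A : 'M[int]_n) (S : setting K A).

Local Notation g := (st_g S).
Local Notation e := (che (st_chev S)).
Local Notation f := (chf (st_chev S)).
Local Notation h := (chh (st_chev S)).
Local Notation L := (st_L S).

(* [x] lies in the weight space of weight - sum_j c_j alpha_j, with c_j >= 0
   not all zero: a negative root space, or the zero space. *)
Definition neg_root_elt (x : g) :=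
  exists c : 'I_n -> nat,
    (exists j, c j != 0%N) /\
    (forall i, bracket (h i) x = - ((\sum_j A i j * (c j)%:Z)%:~R *: x)).

(* The simply connected group G acts faithfully on the direct sum of the
   fundamental modules, and is realized as a subgroup of the product of the
   groups GL(L(Lambda_i)) (Chevalley's construction).  Root subgroups are
   closed under inverses, hence so is the monoid generated by them. *)
Inductive in_Uminus : (forall i, 'End(L i)) -> Prop :=
  | in_Uminus1 : in_Uminus (fun i => \1%VF)
  | in_UminusM : forall x y, in_Uminus x -> in_Uminus y ->
      in_Uminus (fun i => (x i \o y i)%VF)
  | in_Uminus_root : forall x : g, neg_root_elt x ->
      in_Uminus (fun i => nil_exp (act (L i) x)).

Record Uminus := UMinus {
  um_val :> forall i, 'End(L i);
  um_in : in_Uminus um_val }.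

Definition um_one : Uminus := UMinus in_Uminus1.

Definition um_mul (x y : Uminus) : Uminus :=
  UMinus (in_UminusM (um_in x) (um_in y)).

Lemma neg_root_f (j : 'I_n) (t : K) : neg_root_elt (t *: f j).
Proof.
exists (fun k => (k == j) : nat); split; first by exists j; rewrite eqxx.
move=> i.
have -> : \sum_k A i k * ((k == j) : nat)%:Z = A i j.
  rewrite (bigD1 j) //= eqxx mulr1 big1 ?addr0 // => k /negPf ->.
  by rewrite mulr0.
have br0 : bracket (h i) (0 : g) = 0.
  have := bracket_linr (- 1) 0 0 (h i).
  by rewrite scaler0 addr0 scaleN1r addNr.
have := bracket_linr t (f j) 0 (h i); rewrite !addr0 br0 addr0 => ->.
by rewrite chev_hf scalerN scalerA mulrC -scalerA.
Qed.

Definition um_y (j : 'I_n) (t : K) : Uminus :=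
  UMinus (in_Uminus_root (neg_root_f j t)).

(* For a reduced word all the exponents (s_{j_{k+1}} ... s_{j_N} Lambda_i)(h_{j_k})
   are nonnegative, so that the absolute value has no effect. *)
Fixpoint extremal_vec (i : 'I_n) (w : seq 'I_n) : L i :=
  if w is j :: w' then
    div_pow (act (L i) (f j)) `|weyl_act A w' (fund_weight i) j|%N
      (extremal_vec i w')
  else fm_u (L i).

(* [w] is the reduced word of the longest element used to define the lowest
   weight vector v_{Lambda_i}. *)
Definition Fcoef (w : seq 'I_n) (i : 'I_n) (x : Uminus) : K :=
  fm_form (x i (fm_u (L i))) (extremal_vec i w).

End Group.

Arguments Fcoef {K n A} S w i x.

(** * The products y *)

(* The node numbered [j] from 1 to [m.+1]. *)
Definition node (m j : nat) : 'I_m.+1 := inord j.-1.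

(* y_{j_1}(t_1) y_{j_2}(t_2) ..., for a list of pairs (j, t), where [j] is
   numbered from 1. *)
Definition y_prod (K : fieldType) (m : nat) (A : 'M[int]_m.+1)
    (S : setting K A) (s : seq (nat * K)) : Uminus S :=
  foldr (fun p x => um_mul (um_y S (node m p.1) p.2) x) (um_one S) s.

Section Words.
Variables (K : fieldType) (n : nat) (a abar : nat -> nat -> K).

Definition bracketA (k : nat) : seq (nat * K) :=
  [seq (j, a k j) | j <- rev (index_iota k n.+1)].

Definition wordA : seq (nat * K) :=
  flatten [seq bracketA k | k <- index_iota 1 n.+1].

Definition bracketBC (k : nat) : seq (nat * K) :=
  [seq (j, a k j) | j <- index_iota k n.+1]
    ++ [seq (j, abar k j) | j <- rev (index_iota k n)].

Definition wordBC : seq (nat * K) :=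
  flatten [seq bracketBC k | k <- index_iota 1 n.+1].

Definition bracketD (k : nat) : seq (nat * K) :=
  [seq (j, a k j) | j <- index_iota k n]
    ++ (n, abar k n.-1) :: [seq (j, abar k j) | j <- rev (index_iota k n.-1)].

Definition wordD : seq (nat * K) :=
  flatten [seq bracketD k | k <- index_iota 1 n].

End Words.

(* Main.v *)
From HB Require Import structures.
From mathcomp Require Import all_boot all_order all_algebra.
From mathcomp Require Import zify ring lra.
From mathcomp Require Import boolp reals complex.
Require Import Defs.

Set Implicit Arguments.
Unset Strict Implicit.
Unset Printing Implicit Defensive.

Import Order.TTheory GRing.Theory Num.Theory.
Local Open Scope ring_scope.

(** In all four types the word [s] of the product [y] is a reduced word of the
    longest element, and the proposition says that [F_i] is then a single
    monomial: if [s = j_1 ... j_N] has parameters [t_1, ..., t_N], then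
    [F_i y] is the product of the [t_k ^ m_k], where [m_k] is the exponent of the
    divided power of [f_(j_k)] in the definition of the lowest weight vector.

    One letter is peeled off at a time ([form_nil_exp]).  Let [v'] be the extremal
    vector of a suffix and [v = f_j^(p) v'] the next one.  Moving
    [exp (t f_j)] to the other side of the form gives the sum of the
    [t^k <z, e_j^(k) v>].  The terms with [k > p] vanish since [e_j v' = 0], the
    term with [k = p] is [t^p <z, v'>], and those with [k < p] vanish because [z]
    lies in the Demazure module [U(n+) v'], whose weights are at least that of
    [v'].  That Demazure modules absorb the successive [exp (t f_j)] is
    elementary: [U(n+) v] contains [v'], and it is stable under [f_j] because
    [f_j v = 0].  The vanishing of [e_j v'] and [f_j v] follows from the invariance
    of the weights of [L(Lambda_i)] under the Weyl group ([extremal_e],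
    [extremal_f]).

    The lowest weight vector is defined by an arbitrary longest word [w], so two
    more facts are needed.  The exponents along a reduced word are nonnegative and
    a longest word leads to an antidominant weight ([reduced_descending],
    [longest_antidominant]); both come from the [exchange] property, which is
    deduced here from the weights of the fundamental modules, without a case
    analysis of root systems.  And the extremal vector depends only on its weight
    ([extremal_vec_unique]).  This is a confluence argument: the words are
    strictly descending paths in the orbit of [Lambda_i], and it is enough to close
    the branchings by two simple reflections [s_j], [s_k].  In the orbits of
    fundamental weights of classical type, a branching occurs only when [f_j] and
    [f_k] commute, or in type [A_2] with both exponents [1], where it closes by the
    consequence [f_j f_k^(2) f_j = f_k f_j^(2) f_k] of the Serre relations.

    What remains is to follow the weight [Lambda_i] along the given words, in the
    usual coordinates in which the Weyl group acts by permutations and changes of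
    sign: each bracket of [y] carries one coordinate from one end to the other,
    in types [B], [C], [D] also changing its sign on the way ([runs_up],
    [runs_down]). *)

(** * Representations of [sl_2] *)

Lemma iter_lfun0 (K : fieldType) (V : vectType K) (f : 'End(V)) k :
  iter k f 0 = 0.
Proof. by elim: k => //= k ->; rewrite linear0. Qed.

Section Eigenvectors.
Variables (K : numFieldType) (V : vectType K) (h f : 'End(V)) (a c : K) (z : V).
Hypothesis c_neq0 : c != 0.
Hypothesis hf : forall x, h (f x) = f (h x) + c *: f x.
Hypothesis hz : h z = a *: z.

Lemma eigen_iter k : h (iter k f z) = (a + c *+ k) *: iter k f z.
Proof.
elim: k => [|k IH] /=; first by rewrite addr0.
by rewrite hf IH linearZ /= -scalerDl mulrSr addrA.
Qed.

Lemma eigen_iter_indep k (b : nat -> K) :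
  (forall j, (j < k)%N -> iter j f z != 0) ->
  \sum_(j < k) b j *: iter j f z = 0 -> forall j, (j < k)%N -> b j = 0.
Proof.
elim: k b => [//|k IH] b nz sum0.
have low j : (j < k)%N -> b j = 0.
  move=> jk.
  have /eqP : b j * (c *+ j - c *+ k) = 0.
    apply: (IH (fun j => b j * (c *+ j - c *+ k))) jk => [l lk|].
      by apply: nz; apply: ltnW.
    have := congr1 h sum0; rewrite linear0 linear_sum /=.
    have := congr1 (fun x => (a + c *+ k) *: x) sum0.
    rewrite scaler0 scaler_sumr => s1 s2.
    have := congr2 (fun x y : V => x - y) s2 s1.
    rewrite /= subr0 -sumrB big_ord_recr /= linearZ /= eigen_iter.
    rewrite !scalerA [X in _ *: _ - X *: _]mulrC subrr addr0 => s3.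
    rewrite -[RHS]s3; apply: eq_bigr => l _.
    rewrite linearZ /= eigen_iter !scalerA -scalerBl; congr (_ *: _); ring.
  rewrite mulf_eq0 => /orP[/eqP //|].
  rewrite -[c *+ j]mulr_natr -[c *+ k]mulr_natr -mulrBr mulf_eq0 (negPf c_neq0).
  rewrite /= subr_eq0 eqr_nat.
  by rewrite ltn_eqF.
move=> j; rewrite ltnS leq_eqVlt => /orP[/eqP -> |]; last exact: low.
move: sum0; rewrite big_ord_recr /= big1 ?add0r.
  by move/eqP; rewrite scaler_eq0 (negPf (nz k _)) // orbF => /eqP.
by move=> l _; rewrite low // scale0r.
Qed.

(** The vectors [f^k z] are eigenvectors of [h] for distinct eigenvalues,
    hence independent as long as they do not vanish. *)
Lemma eigen_iter_eq0 k : (\dim {:V} <= k)%N -> iter k f z = 0.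
Proof.
set d := \dim _ => dk.
have stop j : iter j f z = 0 -> forall l, (j <= l)%N -> iter l f z = 0.
  move=> zj l /subnK <-; rewrite iterD zj.
  exact: iter_lfun0.
case: (pselect (exists2 j, (j < d.+1)%N & iter j f z = 0)) => [[j jd zj]|nz].
  by apply: (stop j) => //; lia.
have fr : free [tuple iter j f z | j < d.+1].
  apply/freeP => b s0 i.
  have := @eigen_iter_indep d.+1 (fun j => b (inord j)).
  move/(_ _ _ i (ltn_ord i)); rewrite inord_val; apply.
    by move=> j jd; apply/eqP => zj; apply: nz; exists j.
  rewrite -[RHS]s0; apply: eq_bigr => j _.
  by rewrite inord_val (nth_map j) ?nth_ord_enum // size_enum_ord.
move: (fr); rewrite /free size_tuple => /eqP dimd.
have := dimvS (subvf <<[tuple iter j f z | j < d.+1]>>%VS).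
by rewrite dimd -/d ltnn.
Qed.

End Eigenvectors.

Section SL2.
Variables (K : numFieldType) (V : vectType K) (e f h : 'End(V)).
Hypothesis ef : forall x, e (f x) = f (e x) + h x.
Hypothesis he : forall x, h (e x) = e (h x) + 2 *: e x.
Hypothesis hf : forall x, h (f x) = f (h x) - 2 *: f x.

Lemma hf_neg x : h (f x) = f (h x) + (- 2) *: f x.
Proof. by rewrite hf scaleNr. Qed.

Lemma sl2_weight_f (a : K) z k : h z = a *: z ->
  h (iter k f z) = (a - 2 *+ k) *: iter k f z.
Proof. by move=> hz; rewrite (eigen_iter hf_neg hz) mulNrn. Qed.

Lemma sl2_weight_e (a : K) z k : h z = a *: z ->
  h (iter k e z) = (a + 2 *+ k) *: iter k e z.
Proof. by move=> hz; rewrite (eigen_iter he hz). Qed.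

Lemma sl2_nilp_f (a : K) z k : h z = a *: z -> (\dim {:V} <= k)%N ->
  iter k f z = 0.
Proof.
move=> hz; apply: (eigen_iter_eq0 (c := - 2) _ hf_neg hz).
by rewrite oppr_eq0 pnatr_eq0.
Qed.

Lemma sl2_nilp_e (a : K) z k : h z = a *: z -> (\dim {:V} <= k)%N ->
  iter k e z = 0.
Proof.
by move=> hz; apply: (eigen_iter_eq0 (c := 2) _ he hz); rewrite pnatr_eq0.
Qed.

Lemma sl2_commute (a : K) z k : h z = a *: z ->
  iter k.+1 e (f z) = f (iter k.+1 e z) + (k.+1%:R * (a + k%:R)) *: iter k e z.
Proof.
move=> hz; elim: k => [|k IH]; first by rewrite /= ef hz mul1r addr0.
rewrite iterS IH linearD linearZ /= ef -!iterS (sl2_weight_e _ hz) -addrA.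
rewrite -scalerDl; congr (_ + _ *: _).
by rewrite -natr1; ring.
Qed.

(** Each application of [f] multiplies the scalar by
    [(b + k + 1) (p - b + k)], by [sl2_commute]; this is not zero as long as
    [b < p]. *)
Lemma sl2_raise (p k b : nat) z : h z = p%:R *: z -> iter k.+1 e z = 0 ->
  (b <= p)%N ->
  iter (b + k).+1 e (iter b f z) = 0 /\
  exists2 c : K, c != 0 & iter (b + k) e (iter b f z) = c *: iter k e z.
Proof.
move=> hz ek0; elim: b => [|b IH] bp.
  by split => //; exists 1; rewrite ?oner_neq0 // scale1r.
have [|z0 [c c0 ceq]] := IH; first exact: ltnW.
have wb := sl2_weight_f b hz.
rewrite addSn [iter b.+1 f z]/=; split.
  rewrite (sl2_commute _ wb) z0 scaler0 addr0 [iter _.+2 _ _]iterS z0.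
  by rewrite !linear0.
exists ((b + k).+1%:R * (p%:R - 2 *+ b + (b + k)%:R) * c).
  rewrite mulf_neq0 // mulf_neq0 ?pnatr_eq0 //.
  have -> : p%:R - 2 *+ b + (b + k)%:R = (p - b + k)%:R :> K.
    rewrite natrD natrD natrB 1?ltnW // -[2 *+ b]mulr_natr; ring.
  rewrite pnatr_eq0; lia.
by rewrite (sl2_commute _ wb) z0 linear0 add0r ceq scalerA.
Qed.

(** If [e^(k+1) z = 0] then [e^(p+k) f^p z] is a nonzero multiple of [e^k z];
    so [f^p z = 0] forces [e^k z = 0] for smaller and smaller [k]. *)
Lemma sl2_lower_neq0 (p : nat) z : h z = p%:R *: z -> z != 0 ->
  iter p f z != 0.
Proof.
move=> hz; apply: contraNneq => fp0.
have : iter (\dim {:V}) e z = 0 by apply: (sl2_nilp_e hz).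
elim: (\dim _) => [/= -> //|k IH] ek.
have [_ [c c0]] := sl2_raise hz ek (leqnn p).
rewrite fp0 iter_lfun0 => /esym/eqP.
by rewrite scaler_eq0 (negPf c0) /= => /eqP; apply: IH.
Qed.

Lemma sl2_primitive (a : K) z k : h z = a *: z -> e z = 0 ->
  iter k e (iter k f z) = (k`!%:R * \prod_(j < k) (a - j%:R)) *: z.
Proof.
move=> hz ez; elim: k => [|k IH]; first by rewrite big_ord0 mulr1 scale1r.
have wk := sl2_weight_f k hz.
rewrite [iter k.+1 f z]/= (sl2_commute _ wk) iterS IH linearZ /= ez scaler0.
rewrite linear0 add0r scalerA big_ord_recr /= factS natrM.
congr (_ *: _); rewrite -[2 *+ k]mulr_natr; ring.
Qed.

End SL2.

(** * Weights and the Weyl group *)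

Section Weyl.
Variables (n : nat) (A : 'M[int]_n).

Definition simple_root (k : 'I_n) : weight n := [ffun j => A j k].

Definition root_comb (c : 'I_n -> int) : weight n :=
  [ffun j => \sum_k A j k * c k].

Lemma simple_reflB j : {morph simple_refl A j : l l' / l - l'}.
Proof. by move=> l l'; apply/ffunP => k; rewrite !ffunE; ring. Qed.

Lemma weyl_actB w : {morph weyl_act A w : l l' / l - l'}.
Proof. by move=> l l'; elim: w => //= j w ->; rewrite simple_reflB. Qed.

HB.instance Definition _ w :=
  GRing.isZmodMorphism.Build (weight n) (weight n) (weyl_act A w) (weyl_actB w).

Lemma weyl_act_cat w w' l :
  weyl_act A (w ++ w') l = weyl_act A w (weyl_act A w' l).
Proof. exact: foldr_cat. Qed.

Lemma weightMz (l : weight n) (z : int) j : (l *~ z) j = l j * z.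
Proof.
have mulrn_weight k : (l *+ k) j = l j *+ k.
  by elim: k => [|k IH]; rewrite ?mulr0n ?ffunE // !mulrS ffunE IH.
case: z => k; first by rewrite -pmulrn mulrn_weight -mulr_natr natz.
by rewrite NegzE mulrNz ffunE -pmulrn mulrn_weight mulrN -mulr_natr natz.
Qed.

Lemma simple_reflE j l : simple_refl A j l = l - simple_root j *~ l j.
Proof. by apply/ffunP => k; rewrite !ffunE weightMz ffunE mulrC. Qed.

Lemma weight_fund (l : weight n) : l = \sum_i fund_weight i *~ l i.
Proof.
apply/ffunP => k; rewrite sum_ffunE (bigD1 k) //= big1 => [|i ik].
  by rewrite addr0 weightMz ffunE eqxx mul1r.
by rewrite weightMz ffunE (negPf ik) mul0r.
Qed.

Lemma weyl_act_fund w l j :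
  weyl_act A w l j = \sum_i weyl_act A w (fund_weight i) j * l i.
Proof.
rewrite {1}(weight_fund l) raddf_sum sum_ffunE; apply: eq_bigr => i _.
by rewrite raddfMz weightMz.
Qed.

Lemma root_comb_ext c c' : c =1 c' -> root_comb c = root_comb c'.
Proof.
move=> cc'; apply/ffunP => j; rewrite !ffunE.
by apply: eq_bigr => k _; rewrite cc'.
Qed.

Lemma root_comb_delta k : root_comb (fun i => (i == k)%:Z) = simple_root k.
Proof.
apply/ffunP => j; rewrite !ffunE (bigD1 k) //= eqxx mulr1 big1 ?addr0 // => i.
by move=> /negPf ->; rewrite mulr0.
Qed.

Lemma root_combD c c' :
  root_comb (fun k => c k + c' k) = root_comb c + root_comb c'.
Proof.
apply/ffunP => j; rewrite !ffunE -big_split.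
by apply: eq_bigr => k _; rewrite mulrDr.
Qed.

Lemma root_combN c : root_comb (fun k => - c k) = - root_comb c.
Proof.
by apply/ffunP => j; rewrite !ffunE -sumrN; apply: eq_bigr => k _; rewrite mulrN.
Qed.

Lemma root_combMz c z :
  root_comb (fun k => c k * z) = root_comb c *~ z.
Proof.
apply/ffunP => j; rewrite weightMz !ffunE mulr_suml.
by apply: eq_bigr => k _; rewrite mulrA.
Qed.

Lemma weyl_act_root_comb w c : exists c', weyl_act A w (root_comb c) = root_comb c'.
Proof.
elim: w => [|j w [c' IH]]; first by exists c.
exists (fun k => c' k - (k == j)%:Z * root_comb c' j).
rewrite /= -/(weyl_act A w _) IH simple_reflE -root_comb_delta.
by rewrite -root_combMz -root_combN -root_combD.
Qed.

Hypothesis Adiag : forall j, A j j = 2.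

Lemma simple_reflK j : involutive (simple_refl A j).
Proof. by move=> l; apply/ffunP => k; rewrite !ffunE Adiag; ring. Qed.

Lemma weyl_act_revK w : cancel (weyl_act A w) (weyl_act A (rev w)).
Proof.
move=> l; elim: w l => //= j w IH l.
by rewrite rev_cons -cats1 weyl_act_cat /= simple_reflK IH.
Qed.

Lemma weyl_actK_rev w : cancel (weyl_act A (rev w)) (weyl_act A w).
Proof. by move=> l; rewrite -{1}[w]revK weyl_act_revK. Qed.

End Weyl.

(** * Weight vectors in modules *)

(** A subspace of maximal dimension among those contained in [P] is all of [P]:
    adding a vector of [P] to it does not increase the dimension. *)
Lemma subspace_vspace (K : fieldType) (V : vectType K) (P : V -> Prop) :
  P 0 -> (forall (c : K) x y, P x -> P y -> P (c *: x + y)) ->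
  exists W : {vspace V}, forall x, x \in W <-> P x.
Proof.
move=> P0 Plin.
pose sub d := `[< exists2 W : {vspace V}, \dim W = d & forall x, x \in W -> P x >].
have sub0 : exists d, sub d.
  exists 0%N; apply/asboolP; exists 0%VS; first exact: dimv0.
  by move=> x; rewrite memv0 => /eqP ->.
have subd d : sub d -> (d <= \dim {:V})%N.
  by move/asboolP => [W <- _]; apply: dimvS; apply: subvf.
case: (ex_maxnP sub0 subd) => d /asboolP[W dW WP] maxd.
exists W => x; split=> [/WP //|Px].
have /maxd : sub (\dim (W + <[x]>)%VS).
  apply/asboolP; exists (W + <[x]>)%VS => // y /memv_addP[w wW [v /vlineP[c ->] ->]].
  by rewrite addrC; apply: Plin => //; apply: WP.
rewrite -dW => dle; have sW : (W <= W + <[x]>)%VS by apply: addvSl.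
have := dimv_leqif_eq sW => -[le1]; rewrite eqn_leq le1 dle => /esym/eqP eqW.
by rewrite eqW; apply: subvP (addvSr _ _) _ (memv_line x).
Qed.

Section LieModule.
Variables (K : numFieldType) (n : nat) (A : 'M[int]_n) (g : lieAlgebra K).
Variable C : chevalley A g.

Lemma act0 (V : lieModule g) : act V 0 = 0.
Proof.
have := act_lin V (- 1) 0 0; rewrite scaler0 addr0 => {1}->.
by rewrite scaleN1r addNr.
Qed.

(** The elements of [g] that preserve [P] form a Lie subalgebra. *)
Lemma chev_stable (V : lieModule g) (P : V -> Prop) :
  P 0 -> (forall (c : K) x y, P x -> P y -> P (c *: x + y)) ->
  (forall j x, P x -> P (act V (che C j) x)) ->
  (forall j x, P x -> P (act V (chf C j) x)) ->
  forall y x, P x -> P (act V y x).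
Proof.
move=> P0 Plin Pe Pf.
have [||W WP] := @subspace_vspace K g (fun y => forall x, P x -> P (act V y x)).
- by move=> x _; rewrite act0 lfunE.
- move=> c y z sy sz x Px.
  by rewrite act_lin add_lfunE scale_lfunE; apply: Plin; [apply: sy|apply: sz].
suff Wf : W = fullv by move=> y; apply/WP; rewrite Wf memvf.
apply: (chev_gen (c := C)) => [y z /WP sy /WP sz|j|j]; apply/WP=> x Px.
- rewrite act_bracket add_lfunE opp_lfunE !comp_lfunE addrC -scaleN1r.
  by apply: Plin; [apply: sz; apply: sy | apply: sy; apply: sz].
- exact: Pe.
- exact: Pf.
Qed.

Variable V : lieModule g.
Local Notation E j := (act V (che C j)).
Local Notation F j := (act V (chf C j)).
Local Notation H j := (act V (chh C j)).

Lemma act_scale (c : K) y : act V (c *: y) = c *: act V y.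
Proof.
by have := act_lin V c y 0; rewrite addr0 act0 addr0.
Qed.

Lemma act_commute y z x :
  act V y (act V z x) = act V z (act V y x) + act V (bracket y z) x.
Proof. by rewrite act_bracket add_lfunE opp_lfunE !comp_lfunE addrC subrK. Qed.

Lemma act_ef j k x : E j (F k x) = F k (E j x) + (if j == k then H j x else 0).
Proof.
rewrite act_commute chev_ef; case: eqP => // _.
by rewrite act0 lfunE.
Qed.

Lemma act_he j k x : H j (E k x) = E k (H j x) + (A j k)%:~R *: E k x.
Proof. by rewrite act_commute chev_he act_scale scale_lfunE. Qed.

Lemma act_hf j k x : H j (F k x) = F k (H j x) - (A j k)%:~R *: F k x.
Proof.
by rewrite act_commute chev_hf -scaleNr act_scale scale_lfunE scaleNr.
Qed.

Definition weight_vec (l : weight n) (x : V) :=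
  forall j, H j x = (l j)%:~R *: x.

Lemma weight_vec_scale l (c : K) x : weight_vec l x -> weight_vec l (c *: x).
Proof. by move=> lx j; rewrite linearZ /= lx !scalerA mulrC. Qed.

Lemma weight_vec_e l x j :
  weight_vec l x -> weight_vec (l + simple_root A j) (E j x).
Proof.
by move=> lx k; rewrite act_he lx linearZ /= -scalerDl !ffunE intrD.
Qed.

Lemma weight_vec_f l x j :
  weight_vec l x -> weight_vec (l - simple_root A j) (F j x).
Proof.
by move=> lx k; rewrite act_hf lx linearZ /= -scalerBl !ffunE intrB.
Qed.

Lemma weight_vec_iter_e l x j k :
  weight_vec l x -> weight_vec (l + simple_root A j *+ k) (iter k (E j) x).
Proof.
move=> lx; elim: k => [|k IH]; first by rewrite addr0.
by rewrite mulrSr addrA; apply: weight_vec_e.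
Qed.

Lemma weight_vec_iter_f l x j k :
  weight_vec l x -> weight_vec (l - simple_root A j *+ k) (iter k (F j) x).
Proof.
move=> lx; elim: k => [|k IH]; first by rewrite subr0.
by rewrite mulrSr opprD addrA; apply: weight_vec_f.
Qed.

Hypothesis Adiag : forall j, A j j = 2.

Lemma act_ef_diag j x : E j (F j x) = F j (E j x) + H j x.
Proof. by rewrite act_ef eqxx. Qed.

Lemma act_fe_diag j x : F j (E j x) = E j (F j x) + (- H j) x.
Proof. by rewrite act_ef_diag opp_lfunE addrK. Qed.

Lemma act_he_diag j x : H j (E j x) = E j (H j x) + 2 *: E j x.
Proof. by rewrite act_he Adiag. Qed.

Lemma act_hf_diag j x : H j (F j x) = F j (H j x) - 2 *: F j x.
Proof. by rewrite act_hf Adiag. Qed.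

(* [f_j], [e_j], [- h_j] is an sl_2-triple too: it yields the statements about
   lowering from those about raising. *)
Lemma act_Nhe_diag j x : (- H j) (E j x) = E j ((- H j) x) - 2 *: E j x.
Proof. by rewrite !opp_lfunE act_he_diag linearN /= opprD. Qed.

Lemma act_Nhf_diag j x : (- H j) (F j x) = F j ((- H j) x) + 2 *: F j x.
Proof. by rewrite !opp_lfunE act_hf_diag linearN /= opprB addrC. Qed.

Lemma iter_f_neq0 l x j (p : nat) :
  weight_vec l x -> l j = p -> x != 0 -> iter p (F j) x != 0.
Proof.
move=> lx lj; apply: (sl2_lower_neq0 (act_ef_diag j) (act_he_diag j) (act_hf_diag j)).
by rewrite lx lj.
Qed.

Lemma iter_e_neq0 l x j (p : nat) :
  weight_vec l x -> l j = - p%:Z -> x != 0 -> iter p (E j) x != 0.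
Proof.
move=> lx lj; apply: (sl2_lower_neq0 (act_fe_diag j) (act_Nhf_diag j) (act_Nhe_diag j)).
by rewrite opp_lfunE lx lj mulrNz scaleNr opprK.
Qed.

(** On the weight space of [l], the power of [f_j] or [e_j] of exponent [`|l j|]
    that leads to the weight space of [s_j l] is injective. *)
Lemma weight_vec_refl l x j : weight_vec l x -> x != 0 ->
  exists2 y, y != 0 & weight_vec (simple_refl A j l) y.
Proof.
move=> lx x0; rewrite simple_reflE; case lj : (l j) => [p|p].
  exists (iter p (F j) x); first exact: iter_f_neq0 lx lj x0.
  exact: weight_vec_iter_f.
have lj' : l j = - p.+1%:Z by rewrite lj NegzE.
exists (iter p.+1 (E j) x); first exact: iter_e_neq0 lx lj' x0.
by rewrite NegzE mulrNz opprK; apply: weight_vec_iter_e.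
Qed.

End LieModule.

Section WordSpan.
Variables (K : fieldType) (V : vectType K) (I : Type).

(** The submodule [U(n+) v] or [U(n-) v], for [X] the family of the [e_k] or of the
    [f_k]: words in the generators replace the enveloping algebra. *)
Inductive word_span (X : I -> 'End(V)) (v : V) : V -> Prop :=
| word_span_word p : word_span X v (foldr (fun k => X k) v p)
| word_span_lin (c : K) x y : word_span X v x -> word_span X v y ->
    word_span X v (c *: x + y).

Variables (X : I -> 'End(V)) (v : V).

Lemma word_span_nil : word_span X v v.
Proof. exact: (word_span_word X v [::]). Qed.

Lemma word_span0 : word_span X v 0.
Proof.
by rewrite -(addNr v) -scaleN1r; apply: word_span_lin; apply: word_span_nil.
Qed.

Lemma word_spanZ (c : K) x : word_span X v x -> word_span X v (c *: x).
Proof.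
move=> sx; rewrite -[_ *: _]addr0; apply: word_span_lin => //.
exact: word_span0.
Qed.

Lemma word_spanD x y : word_span X v x -> word_span X v y -> word_span X v (x + y).
Proof. by move=> sx sy; rewrite -[x]scale1r; apply: word_span_lin. Qed.

Lemma word_span_sum (J : Type) (r : seq J) (P : pred J) (F : J -> V) :
  (forall j, P j -> word_span X v (F j)) ->
  word_span X v (\sum_(j <- r | P j) F j).
Proof.
move=> sF; elim/big_rec: _ => [|j x Pj sx]; first exact: word_span0.
by apply: word_spanD => //; apply: sF.
Qed.

Lemma word_span_gen k x : word_span X v x -> word_span X v (X k x).
Proof.
elim=> [p|c y z _ sy _ sz]; first exact: (word_span_word X v (k :: p)).
by rewrite linearP; apply: word_span_lin.
Qed.

Lemma word_span_iter k q x : word_span X v x -> word_span X v (iter q (X k) x).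
Proof. by move=> sx; elim: q => //= q; apply: word_span_gen. Qed.

(** [Y] moves through a word one letter at a time, leaving multiples of shorter
    words behind, until it reaches [v]. *)
Lemma word_span_stable (Y : 'End(V)) :
  (forall k p, exists c : K, let z := foldr (fun k => X k) v p in
     Y (X k z) = X k (Y z) + c *: z) ->
  Y v = 0 -> forall x, word_span X v x -> word_span X v (Y x).
Proof.
move=> YX Yv x; elim=> [p|c y z _ sy _ sz]; last first.
  by rewrite linearP; apply: word_span_lin.
elim: p => [|k p IH] /=; first by rewrite Yv; apply: word_span0.
have [c ->] := YX k p; apply: word_spanD; first exact: word_span_gen.
by apply/word_spanZ/word_span_word.
Qed.

End WordSpan.

Section WeightWords.
Variables (K : numFieldType) (n : nat) (A : 'M[int]_n) (g : lieAlgebra K).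
Variables (C : chevalley A g) (V : lieModule g) (l : weight n) (v : V).
Hypothesis lv : weight_vec C l v.
Local Notation E := (fun j => act V (che C j)).
Local Notation F := (fun j => act V (chf C j)).

Lemma weight_vec_e_word p : exists c : 'I_n -> nat,
  weight_vec C (l + root_comb A (fun k => (c k)%:Z)) (foldr (fun k => E k) v p).
Proof.
elim: p => [|j p [c IH]] /=.
  exists (fun _ => 0%N); suff -> : root_comb A (fun=> 0) = 0 by rewrite addr0.
  by apply/ffunP => j; rewrite !ffunE big1 // => k _; rewrite mulr0.
exists (fun k => c k + (k == j))%N.
have -> : root_comb A (fun k => (c k + (k == j))%N%:Z) =
    root_comb A (fun k => (c k)%:Z) + simple_root A j.
  by rewrite -root_comb_delta -root_combD; apply: root_comb_ext => k; rewrite PoszD.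
by rewrite addrA; apply: weight_vec_e.
Qed.

Lemma weight_vec_f_word p : exists c : 'I_n -> nat,
  weight_vec C (l - root_comb A (fun k => (c k)%:Z)) (foldr (fun k => F k) v p).
Proof.
elim: p => [|j p [c IH]] /=.
  exists (fun _ => 0%N); suff -> : root_comb A (fun=> 0) = 0 by rewrite subr0.
  by apply/ffunP => j; rewrite !ffunE big1 // => k _; rewrite mulr0.
exists (fun k => c k + (k == j))%N.
have -> : root_comb A (fun k => (c k + (k == j))%N%:Z) =
    root_comb A (fun k => (c k)%:Z) + simple_root A j.
  by rewrite -root_comb_delta -root_combD; apply: root_comb_ext => k; rewrite PoszD.
by rewrite opprD addrA; apply: weight_vec_f.
Qed.

Lemma e_word_span_stable_f j : F j v = 0 ->
  forall x, word_span E v x -> word_span E v (F j x).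
Proof.
apply: word_span_stable => k p; set z := foldr _ _ _.
have [c wz] := weight_vec_e_word p; rewrite -/z in wz.
rewrite /= act_ef; case: eqP => [->|_]; last first.
  by exists 0; rewrite addr0 scale0r addr0.
by rewrite wz; set a := _%:~R; exists (- a); rewrite scaleNr addrK.
Qed.

Lemma f_word_span_stable_e j : E j v = 0 ->
  forall x, word_span F v x -> word_span F v (E j x).
Proof.
apply: word_span_stable => k p; set z := foldr _ _ _.
have [c wz] := weight_vec_f_word p; rewrite -/z in wz.
rewrite /= act_ef; case: eqP => [->|_].
  by rewrite wz; set a := _%:~R; exists a.
by exists 0; rewrite scale0r.
Qed.

End WeightWords.

(** * The contravariant form and the weights of fundamental modules *)

Section Form.
Variables (K : numFieldType) (n : nat) (A : 'M[int]_n) (g : lieAlgebra K).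
Variables (C : chevalley A g) (i : 'I_n) (V : fundModule C i).
Local Notation form := (@fm_form _ _ _ _ C i V).
Local Notation E j := (act V (che C j)).
Local Notation F j := (act V (chf C j)).
Local Notation H j := (act V (chh C j)).

Lemma form0l y : form 0 y = 0.
Proof.
have := fm_form_lin (- 1) (0 : V) 0 y; rewrite scaler0 addr0 => {1}->.
by rewrite mulN1r addNr.
Qed.

Lemma formZl (c : K) x y : form (c *: x) y = c * form x y.
Proof. by rewrite -[c *: x]addr0 fm_form_lin form0l addr0. Qed.

Lemma formDl x y z : form (x + y) z = form x z + form y z.
Proof. by rewrite -[x]scale1r fm_form_lin mul1r scale1r. Qed.

Lemma formZr (c : K) x y : form x (c *: y) = c * form x y.
Proof. by rewrite !(fm_form_sym x) formZl. Qed.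

Lemma formDr x y z : form z (x + y) = form z x + form z y.
Proof. by rewrite !(fm_form_sym z) formDl. Qed.

Lemma form0r y : form y 0 = 0.
Proof. by rewrite fm_form_sym form0l. Qed.

Lemma form_suml (J : Type) (r : seq J) (G : J -> V) y :
  form (\sum_(j <- r) G j) y = \sum_(j <- r) form (G j) y.
Proof.
elim: r => [|j r IH]; first by rewrite !big_nil form0l.
by rewrite !big_cons formDl IH.
Qed.

Lemma form_e j x y : form (E j x) y = form x (F j y).
Proof. exact: (fm_form_omega [:: LetE j]). Qed.

Lemma form_f j x y : form (F j x) y = form x (E j y).
Proof. exact: (fm_form_omega [:: LetF j]). Qed.

Lemma form_h j x y : form (H j x) y = form x (H j y).
Proof. exact: (fm_form_omega [:: LetH j]). Qed.

Lemma form_iter_f j k x y : form (iter k (F j) x) y = form x (iter k (E j) y).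
Proof. by elim: k x y => //= k IH x y; rewrite form_f IH -iterSr. Qed.

Lemma form_weight_neq l l' (x y : V) :
  weight_vec C l x -> weight_vec C l' y -> l != l' -> form x y = 0.
Proof.
move=> lx ly; apply: contra_neq_eq => xy0; apply/ffunP => j.
have := form_h j x y; rewrite lx ly formZl formZr => /eqP.
by rewrite -subr_eq0 -mulrBl mulf_eq0 (negPf xy0) orbF subr_eq0 eqr_int => /eqP.
Qed.

Lemma fm_u_weight : weight_vec C (fund_weight i) (fm_u V).
Proof. by move=> j; apply: fm_u_h. Qed.

(** The radical of the form is a submodule which misses [u]. *)
Lemma form_nondeg (x : V) : (forall y, form x y = 0) -> x = 0.
Proof.
pose P (x : V) := forall y, form x y = 0.
have P0 : P 0 by move=> y; rewrite form0l.
have Plin (c : K) (a b : V) : P a -> P b -> P (c *: a + b).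
  by move=> Pa Pb y; rewrite formDl formZl Pa Pb mulr0 addr0.
have [W WP] := subspace_vspace P0 Plin.
move=> Px; have xW : x \in W by apply/WP.
have [|W0|Wf] := proj2 (fm_irr V) W.
- move=> y v /WP Pv; apply/WP; move: y v Pv; apply: (chev_stable (C := C)) => //.
  + by move=> j v Pv y; rewrite form_e.
  + by move=> j v Pv y; rewrite form_f.
- by move: xW; rewrite W0 memv0 => /eqP.
have /WP/(_ (fm_u V)) : fm_u V \in W by rewrite Wf memvf.
by rewrite fm_form_u => /eqP; rewrite oner_eq0.
Qed.

(** The span of the [f]-words is stable under the [e_j], since these kill [u];
    so it is a submodule. *)
Lemma f_word_spanning (x : V) :
  word_span (fun j => act V (chf C j)) (fm_u V) x.
Proof.
set P := word_span _ _.
have P0 : P 0 by apply: word_span0.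
have Plin (c : K) (a b : V) : P a -> P b -> P (c *: a + b).
  exact: word_span_lin.
have [W WP] := subspace_vspace P0 Plin; apply/WP.
have [|W0|-> //] := proj2 (fm_irr V) W; last exact: memvf.
- move=> y v /WP Pv; apply/WP; move: y v Pv; apply: (chev_stable (C := C)) => //.
  + by move=> j; apply: (f_word_span_stable_e fm_u_weight); apply: fm_u_e.
  + by move=> j; apply: word_span_gen.
have /WP : P (fm_u V) by apply: word_span_nil.
by rewrite W0 memv0 (negPf (fm_u_neq0 V)).
Qed.

(** A vector of any other weight is orthogonal to all the [f]-words. *)
Lemma weight_le l (x : V) : x != 0 -> weight_vec C l x ->
  exists c : 'I_n -> nat, l = fund_weight i - root_comb A (fun k => (c k)%:Z).
Proof.
move=> x0 lx; apply: contrapT => nl; move/eqP: x0; apply.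
apply: form_nondeg => y; elim: (f_word_spanning y) => [p|c a b _ sa _ sb].
  have [c wc] := weight_vec_f_word fm_u_weight p.
  by apply: form_weight_neq lx wc _; apply/eqP => lc; apply: nl; exists c.
by rewrite formDr formZr sa sb mulr0 addr0.
Qed.

End Form.

Section Setting.
Variables (K : numFieldType) (n : nat) (A : 'M[int]_n) (S : setting K A).
Local Notation g := (st_g S).
Local Notation C := (st_chev S).
Local Notation L := (st_L S).

(** A row [z] killed by the Cartan matrix gives a central element
    [\sum_j z_j h_j], which vanishes as [g] is simple; its eigenvalue on the
    highest weight vector of [L i] is [z_i]. *)
Lemma cartan_unit : map_mx intr A \in @unitmx K n.
Proof.
rewrite -row_free_unit; apply: inj_row_free => z zA.
pose Z : g := \sum_j z 0 j *: chh C j.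
have br0 (x : g) : bracket 0 x = 0.
  have := bracket_linl (- 1) 0 0 x; rewrite scaler0 addr0 => {1}->.
  by rewrite scaleN1r addNr.
have brZ (x : g) : bracket Z x = \sum_j z 0 j *: bracket (chh C j) x.
  rewrite /Z; elim/big_rec2: _ => [|j y t _ <-]; first exact: br0.
  by rewrite bracket_linl.
have zA' k : \sum_j z 0 j * (A j k)%:~R = 0.
  have := congr1 (fun M : 'rV_n => M 0 k) zA; rewrite !mxE => {2}<-.
  by apply: eq_bigr => j _; rewrite mxE.
have Ze k : bracket Z (che C k) = 0.
  rewrite brZ; under eq_bigr do rewrite chev_he scalerA.
  by rewrite -scaler_suml zA' scale0r.
have Zf k : bracket Z (chf C k) = 0.
  rewrite brZ; under eq_bigr do rewrite chev_hf -scaleNr scalerA mulrN.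
  by rewrite -scaler_suml sumrN zA' oppr0 scale0r.
have anti (x y : g) : bracket x y = - bracket y x.
  have Dl a b t : bracket (a + b) t = bracket a t + bracket b t :> g.
    by have := bracket_linl 1 a b t; rewrite !scale1r.
  have Dr a b t : bracket t (a + b) = bracket t a + bracket t b :> g.
    by have := bracket_linr 1 a b t; rewrite !scale1r.
  have := bracketxx (x + y); rewrite Dl !Dr !bracketxx add0r addr0.
  by move/eqP; rewrite addr_eq0 => /eqP.
have central x : bracket Z x = 0.
  have [||W WP] := @subspace_vspace K g (fun y => bracket Z y = 0).
  - by rewrite anti br0 oppr0.
  - by move=> c y t y0 t0; rewrite bracket_linr y0 t0 scaler0 addr0.
  suff Wf : W = fullv by apply/WP; rewrite Wf memvf.
  apply: (chev_gen (c := C)) => [y t /WP Zy /WP Zt|j|j]; apply/WP => //.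
  have := jacobi Z y t; rewrite Zy [bracket t Z]anti Zt oppr0 [bracket y 0]anti.
  by rewrite br0 [bracket t 0]anti br0 !oppr0 !addr0.
have Z0 : Z = 0.
  have [[x [y xy]] ideals] := st_simple S.
  have [|Z0|Zf'] := ideals <[Z]>%VS.
  - move=> t s /vlineP[c ->]; rewrite anti -[c *: Z]addr0 bracket_linl central.
    by rewrite br0 scaler0 addr0 oppr0 mem0v.
  - by apply/eqP; rewrite -memv0 -Z0 memv_line.
  have /vlineP[c xZ] : x \in <[Z]>%VS by rewrite Zf' memvf.
  by rewrite xZ -[c *: Z]addr0 bracket_linl central br0 scaler0 addr0 eqxx in xy.
apply/rowP => i; rewrite mxE.
have := congr1 (fun y => act (L i) y (fm_u (L i))) Z0; rewrite act0 lfunE /=.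
have -> : act (L i) Z = \sum_j z 0 j *: act (L i) (chh C j).
  rewrite /Z; elim/big_rec2: _ => [|j y t _ <-]; first exact: act0.
  by rewrite act_lin.
rewrite sum_lfunE (bigD1 i) //= big1 ?addr0 => [|j ji];
  rewrite scale_lfunE fm_u_h ffunE.
  rewrite eqxx scale1r => /eqP.
  by rewrite scaler_eq0 (negPf (fm_u_neq0 _)) orbF => /eqP.
by rewrite eq_sym (negPf ji) scale0r scaler0.
Qed.

Lemma root_comb_inj c : root_comb A c = 0 -> forall k, c k = 0.
Proof.
move=> c0 k; pose M := map_mx intr A : 'M[K]_n.
have Mc : M *m (\col_k (c k)%:~R) = 0.
  apply/colP => j; rewrite !mxE.
  have := congr1 (fun l : weight n => (l j)%:~R : K) c0.
  rewrite !ffunE rmorph_sum mulr0z => {2}<-.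
  by apply: eq_bigr => q _; rewrite !mxE rmorphM.
have := mulKmx cartan_unit (\col_k (c k)%:~R); rewrite -/M Mc mulmx0.
by move/colP/(_ k); rewrite !mxE => /esym/eqP; rewrite intr_eq0 => /eqP.
Qed.

End Setting.

(** * Extremal vectors and the exchange property *)

Section Extremal.
Variables (K : numFieldType) (n : nat) (A : 'M[int]_n) (S : setting K A).
Hypothesis Adiag : forall j, A j j = 2.
Local Notation C := (st_chev S).
Local Notation L := (st_L S).
Local Notation E i j := (act (L i) (che C j)).
Local Notation F i j := (act (L i) (chf C j)).
Local Notation H i j := (act (L i) (chh C j)).

Definition has_weight i (l : weight n) :=
  exists2 z : L i, z != 0 & weight_vec C l z.

Lemma has_weight_fund i : has_weight i (fund_weight i).
Proof. by exists (fm_u (L i)); [apply: fm_u_neq0 | apply: fm_u_weight]. Qed.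

Lemma has_weight_act i w l : has_weight i l -> has_weight i (weyl_act A w l).
Proof.
move=> il; elim: w => //= j w [z z0 wz].
by have [y y0 wy] := weight_vec_refl Adiag j wz z0; exists y.
Qed.

Lemma has_weight_addr i b :
  has_weight i (fund_weight i + root_comb A b) -> forall k, b k <= 0.
Proof.
case=> z z0 /(weight_le z0)[c /addrI bc] k.
have : root_comb A (fun k => b k + (c k)%:Z) = 0 by rewrite root_combD bc addNr.
by move/(root_comb_inj S)/(_ k); lia.
Qed.

Lemma has_weight_subr i b :
  has_weight i (fund_weight i - root_comb A b) -> forall k, 0 <= b k.
Proof. by rewrite -root_combN => /has_weight_addr bk k; move: (bk k); lia. Qed.

Lemma simple_root_neq0 j : simple_root A j != 0.
Proof.
by apply/eqP => /ffunP/(_ j); rewrite !ffunE Adiag.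
Qed.

(** Weights are carried to weights by [x^-1], so [Lambda_i + x^-1 alpha_j], resp.
    [Lambda_i - x^-1 alpha_j], is a weight of [L(Lambda_i)], hence [Lambda_i] minus
    a nonnegative combination of simple roots. *)
Lemma root_preimage x j : exists b,
  [/\ weyl_act A (rev x) (simple_root A j) = root_comb A b,
      exists k, b k != 0,
      forall i, has_weight i (weyl_act A x (fund_weight i) + simple_root A j) ->
        forall k, b k <= 0
    & forall i, has_weight i (weyl_act A x (fund_weight i) - simple_root A j) ->
        forall k, 0 <= b k].
Proof.
have [b xb] : exists b, weyl_act A (rev x) (simple_root A j) = root_comb A b.
  by rewrite -root_comb_delta; apply: weyl_act_root_comb.
exists b; split=> // [|i|i].
- apply: contrapT => nb; have b0 : root_comb A b = 0.
    apply/ffunP => k; rewrite !ffunE big1 // => q _.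
    have [->|bq] := eqVneq (b q) 0; first by rewrite mulr0.
    by case: nb; exists q.
  move/eqP: (simple_root_neq0 j); apply.
  by rewrite -[LHS](weyl_actK_rev Adiag x) xb b0 raddf0.
- move/(has_weight_act (rev x)); rewrite raddfD /= xb weyl_act_revK //.
  exact: has_weight_addr.
- move/(has_weight_act (rev x)); rewrite raddfB /= xb weyl_act_revK //.
  exact: has_weight_subr.
Qed.

(** Let [p >= 0] be the value of [x Lambda_i] on [h_j].  If [e_j z] were not zero,
    then neither would be [f_j^2 e_j z], since [e_j z] has the [h_j]-eigenvalue
    [p + 2 >= 2]; so both [x Lambda_i + alpha_j] and [x Lambda_i - alpha_j] would be
    weights, against [root_preimage]. *)
Lemma extremal_e i x j z : weight_vec C (weyl_act A x (fund_weight i)) z ->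
  0 <= weyl_act A x (fund_weight i) j -> E i j z = 0.
Proof.
set l := weyl_act A x _ => lz; case lj : (l j) => [p|//] _.
apply: contrapT => /eqP Ez0.
have wE := weight_vec_e j lz.
have pE : (l + simple_root A j) j = (p.+2)%:Z by rewrite !ffunE lj Adiag; lia.
have := iter_f_neq0 Adiag wE pE Ez0; rewrite -addn2 iterD => F2.
have F20 : iter 2 (F i j) (E i j z) != 0.
  apply: contraNneq F2 => ->; by rewrite iter_lfun0.
have [b [_ [k bk] neg pos]] := root_preimage x j.
have b_le : b k <= 0 by apply: (neg i); exists (E i j z).
have b_ge : 0 <= b k.
  apply: (pos i); exists (iter 2 (F i j) (E i j z)) => //.
  have := weight_vec_iter_f j 2 wE; rewrite -addrA; congr weight_vec.
  by rewrite -/l; congr (_ + _); rewrite mulr2n opprD addrA subrr add0r.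
by move: bk; rewrite eq_le b_le b_ge.
Qed.

Lemma extremal_f i x j z : weight_vec C (weyl_act A x (fund_weight i)) z ->
  weyl_act A x (fund_weight i) j <= 0 -> F i j z = 0.
Proof.
set l := weyl_act A x _ => lz lj0.
have [p lj] : exists p : nat, l j = - p%:Z by exists `|l j|%N; lia.
apply: contrapT => /eqP Fz0.
have wF := weight_vec_f j lz.
have pF : (l - simple_root A j) j = - (p.+2)%:Z by rewrite !ffunE lj Adiag; lia.
have := iter_e_neq0 Adiag wF pF Fz0; rewrite -addn2 iterD => E2.
have E20 : iter 2 (E i j) (F i j z) != 0.
  apply: contraNneq E2 => ->; by rewrite iter_lfun0.
have [b [_ [k bk] neg pos]] := root_preimage x j.
have b_ge : 0 <= b k by apply: (pos i); exists (F i j z).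
have b_le : b k <= 0.
  apply: (neg i); exists (iter 2 (E i j) (F i j z)) => //.
  have := weight_vec_iter_e j 2 wF; rewrite -addrA; congr weight_vec.
  by rewrite -/l; congr (_ + _); rewrite mulr2n addrA addNr add0r.
by move: bk; rewrite eq_le b_le b_ge.
Qed.

(** The coefficients of the coroot [h_j \o x] all have the same sign: a positive
    one gives [f_j z != 0] on a vector of weight [x Lambda_i], a negative one
    [e_j y != 0] on a vector of weight [x Lambda_k], and [root_preimage] excludes
    that both occur. *)
Lemma coroot_coherent x j i k : 0 < weyl_act A x (fund_weight i) j ->
  0 <= weyl_act A x (fund_weight k) j.
Proof.
move=> ci; rewrite leNgt; apply/negP => ck.
have [b [_ [q bq] neg pos]] := root_preimage x j.
have [z z0 wz] := has_weight_act x (has_weight_fund i).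
have [y y0 wy] := has_weight_act x (has_weight_fund k).
have b_ge : 0 <= b q.
  apply: (pos i); exists (F i j z); last exact: weight_vec_f.
  case cp : (weyl_act A x (fund_weight i) j) ci => [[|p]|//] // _.
  have := iter_f_neq0 Adiag wz cp z0; rewrite iterSr; apply: contraNneq => ->.
  by rewrite iter_lfun0.
have b_le : b q <= 0.
  apply: (neg k); exists (E k j y); last exact: weight_vec_e.
  case cp : (weyl_act A x (fund_weight k) j) ck => [//|p] _.
  have cp' : weyl_act A x (fund_weight k) j = - p.+1%:Z by rewrite cp NegzE.
  have := iter_e_neq0 Adiag wy cp' y0; rewrite iterSr; apply: contraNneq => ->.
  by rewrite iter_lfun0.
by move: bq; rewrite eq_le b_le b_ge.
Qed.

(** If [h_j \o x = h_k] then [b := x^-1 alpha_j] is [alpha_k]: both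
    [Lambda_k + (b - alpha_k)] and [Lambda_k - (b - alpha_k)] lie in the Weyl
    orbit of [Lambda_k].  So [x] maps [alpha_k] to [alpha_j]. *)
Lemma reflection_conj x j k : (forall l, weyl_act A x l j = l k) ->
  forall l, simple_refl A j (weyl_act A x l) = weyl_act A x (simple_refl A k l).
Proof.
move=> xjk.
have [b [xb _ _ _]] := root_preimage x j.
pose d q := b q - (q == k)%:Z.
have dE : root_comb A d = root_comb A b - simple_root A k.
  by rewrite /d -root_comb_delta -root_combN -root_combD.
have bk : root_comb A b k = 2.
  by rewrite -xjk -xb weyl_actK_rev // ffunE Adiag.
have fk : fund_weight k k = 1 by rewrite ffunE eqxx.
have up q : d q <= 0.
  apply: (has_weight_addr (i := k)).
  have := has_weight_act (rev x ++ j :: x ++ [:: k]) (has_weight_fund k).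
  congr has_weight; rewrite weyl_act_cat /= -/(weyl_act A _ _) weyl_act_cat /=.
  rewrite simple_reflE xjk raddfB /= raddfMz /= weyl_act_revK // xb.
  have -> : simple_refl A k (fund_weight k) k = -1.
    by rewrite ffunE Adiag fk.
  by rewrite simple_reflE fk mulr1z dE mulrN1z opprK addrAC addrA.
have dn q : 0 <= d q.
  apply: (has_weight_subr (i := k)).
  have := has_weight_act (k :: rev x ++ j :: x) (has_weight_fund k).
  congr has_weight; rewrite /= -/(weyl_act A _ _) weyl_act_cat /=.
  rewrite -/(weyl_act A _ _) [simple_refl A j _]simple_reflE xjk fk mulr1z.
  rewrite raddfB /= weyl_act_revK // xb simple_reflE.
  have -> : (fund_weight k - root_comb A b) k = -1.
    by move: bk; rewrite [in X in X -> _]ffunE !ffunE eqxx => ->.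
  by rewrite mulrN1z opprK dE opprB addrA addrAC.
have bE : root_comb A b = simple_root A k.
  rewrite -root_comb_delta; apply: root_comb_ext => q; apply/eqP.
  by rewrite -subr_eq0 eq_le [_ <= 0]up [0 <= _]dn.
have xk : weyl_act A x (simple_root A k) = simple_root A j.
  by rewrite -bE -xb weyl_actK_rev.
by move=> l; rewrite !simple_reflE xjk raddfB /= [weyl_act A x (_ *~ _)]raddfMz /= xk.
Qed.

Lemma first_failure (T : Type) (P : seq T -> Prop) s : P [::] -> ~ P s ->
  exists p x q, [/\ s = p ++ x :: q, P p & ~ P (rcons p x)].
Proof.
elim/last_ind: s => [//|s x IH] P0 nP; have [Ps|nPs] := pselect (P s).
  by exists s, x, [::]; rewrite cats1.
have [p [y [q [-> Pp nPp]]]] := IH P0 nPs.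
by exists p, y, (rcons q x); rewrite rcons_cat.
Qed.

(** Write [w = x k y] where [h_j \o x] is a nonnegative combination of simple coroots
    but [h_j \o x \o s_k] is not.  Only the coefficient of [h_k] differs, so
    [h_j \o x] is a multiple of [h_k], in fact [h_k] itself by integrality.  Then
    [s_j x = x s_k], and [j x k y] acts as [x y]. *)
Lemma exchange w i j : weyl_act A w (fund_weight i) j < 0 ->
  exists2 w', (size w' < size w)%N & weyl_act A w' =1 weyl_act A (j :: w).
Proof.
move=> wi.
pose P x := forall l, 0 <= weyl_act A x (fund_weight l) j.
have P0 : P [::] by move=> l; rewrite ffunE; case: eqP.
have nP : ~ P w by move/(_ i); rewrite leNgt wi.
have [x [k [y [-> Px nPx]]]] := first_failure P0 nP.
exists (x ++ y) => [|l]; first by rewrite !size_cat /= addnS.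
suff xjk l' : weyl_act A x l' j = l' k.
  rewrite /= -/(weyl_act A _ _) !weyl_act_cat /= -/(weyl_act A _ _).
  by rewrite (reflection_conj xjk) simple_reflK.
have x0 q : q != k -> weyl_act A x (fund_weight q) j = 0.
  move=> qk; apply/eqP; rewrite eq_le Px andbT leNgt; apply/negP => xq.
  apply: nPx => p; apply: (@coroot_coherent _ _ q).
  rewrite -cats1 weyl_act_cat /= simple_reflE.
  by rewrite [fund_weight q k]ffunE (negPf qk) mulr0z subr0.
have xE l1 : weyl_act A x l1 j = weyl_act A x (fund_weight k) j * l1 k.
  rewrite weyl_act_fund (bigD1 k) //= big1 ?addr0 // => q qk.
  by rewrite x0 // mul0r.
(* Evaluated at [x^-1 Lambda_j], the coefficient divides 1. *)
have := xE (weyl_act A (rev x) (fund_weight j)).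
rewrite weyl_actK_rev // [fund_weight j j]ffunE eqxx.
move: (Px k) (xE l'); case: (weyl_act A x (fund_weight k) j) => // c _ ->.
move/esym => c1; suff -> : c = 1%N by rewrite mul1r.
have := congr1 absz c1.
by rewrite abszM /= => /eqP; rewrite muln_eq1 => /andP[/eqP].
Qed.

Fixpoint descending (l : weight n) (w : seq 'I_n) : bool :=
  if w is j :: w' then (0 <= weyl_act A w' l j) && descending l w' else true.

(** If the value of [w Lambda_i] on [h_j] is negative, then [exchange] shortens
    [j :: w]. *)
Lemma reduced_descending w i : reduced_word A w -> descending (fund_weight i) w.
Proof.
elim: w => //= j w IH red; apply/andP; split; last first.
  apply: IH => w' ww'; have := red (j :: w').
  by rewrite ltnS; apply => l /=; congr simple_refl; apply: ww'.
rewrite leNgt; apply/negP => /exchange[w' lt ww'].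
by have := red w' ww'; rewrite leqNgt ltnS ltnW.
Qed.

(** Otherwise [j :: w] would be reduced, hence not longer than [w]: if [w'] acts as
    [j :: w] and is not longer than [w], then [exchange] gives a word shorter than
    [w'] which acts as [j :: w'], that is, as [w]. *)
Lemma longest_antidominant w i j : longest_word A w ->
  weyl_act A w (fund_weight i) j <= 0.
Proof.
case=> red max; rewrite leNgt; apply/negP => wij.
suff /max : reduced_word A (j :: w) by rewrite ltnn.
move=> w' ww'; rewrite leqNgt; apply/negP; rewrite ltnS => le.
have [] := @exchange w' i j.
  rewrite ww' /= -/(weyl_act A w _) ffunE Adiag; move: wij.
  by set a := weyl_act _ _ _ _; lia.
move=> w1 lt w1E; have := red w1; rewrite leqNgt (leq_trans lt le).
suff w1w : weyl_act A w1 =1 weyl_act A w by move/(_ w1w).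
by move=> l; rewrite w1E /= -/(weyl_act A _ _) ww' /= simple_reflK.
Qed.

Lemma div_powE (V : vectType K) (f : 'End(V)) k x :
  div_pow f k x = (k`!%:R)^-1 *: iter k f x.
Proof.
rewrite /div_pow scale_lfunE; congr (_ *: _).
by elim: k => [|k IH] /=; rewrite ?id_lfunE // comp_lfunE IH.
Qed.

Lemma factK_neq0 k : k`!%:R != 0 :> K.
Proof. by rewrite pnatr_eq0 -lt0n fact_gt0. Qed.

Lemma extremal_vec_weight i w : descending (fund_weight i) w ->
  extremal_vec S i w != 0 /\
  weight_vec C (weyl_act A w (fund_weight i)) (extremal_vec S i w).
Proof.
elim: w => [|j w IH] /=; first by split; [apply: fm_u_neq0|apply: fm_u_weight].
rewrite -/(weyl_act A w _) => /andP[+ /IH[v0 wv]].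
case wj : (weyl_act A w (fund_weight i) j) => [p|//] _ /=.
rewrite div_powE; split.
  by rewrite scaler_eq0 invr_eq0 (negPf (factK_neq0 p)) (iter_f_neq0 Adiag wv wj).
rewrite simple_reflE wj; apply: weight_vec_scale.
exact: weight_vec_iter_f.
Qed.

(** * The monomial of a descending word *)

Section Step.
Variables (i j : 'I_n) (w : seq 'I_n) (p : nat).
Hypothesis desc : descending (fund_weight i) w.
Hypothesis wj : weyl_act A w (fund_weight i) j = p.
Let v' := extremal_vec S i w.
Let v := extremal_vec S i (j :: w).

Let v'_e : E i j v' = 0.
Proof. by apply: extremal_e (proj2 (extremal_vec_weight desc)) _; rewrite wj. Qed.

Let desc' : descending (fund_weight i) (j :: w).
Proof. by rewrite /= -/(weyl_act A w _) wj desc. Qed.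

Let vE : v = (p`!%:R)^-1 *: iter p (F i j) v'.
Proof. by rewrite /v /= -/(weyl_act A w _) wj div_powE. Qed.

Lemma extremal_vec_raise : iter p (E i j) v = p`!%:R *: v'.
Proof.
have iterZ k (c : K) x : iter k (E i j) (c *: x) = c *: iter k (E i j) x.
  by elim: k => //= k ->; rewrite linearZ.
have hv' := proj2 (extremal_vec_weight desc) j; rewrite wj in hv'.
rewrite vE iterZ (sl2_primitive (act_ef_diag C j) (act_he_diag C Adiag j)
  (act_hf_diag C Adiag j) p hv' v'_e) scalerA.
suff -> : \prod_(k < p) (p%:~R - k%:R) = p`!%:R :> K.
  by rewrite mulrA mulVf ?factK_neq0 ?mul1r.
rewrite -ffactnn ffact_prod natr_prod; apply: eq_bigr => k _.
by rewrite natrB // ltnW.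
Qed.

Lemma extremal_vec_raise0 k : (p < k)%N -> iter k (E i j) v = 0.
Proof.
move=> pk; rewrite -(subnK pk) iterD iterS extremal_vec_raise linearZ /= v'_e.
by rewrite scaler0 iter_lfun0.
Qed.

Local Notation demazure u := (word_span (fun q => E i q) u).

(** [v'] is recovered from [v] by [extremal_vec_raise]. *)
Lemma demazure_sub x : demazure v' x -> demazure v x.
Proof.
elim=> [q|c a b _ sa _ sb]; last exact: word_span_lin.
elim: q => [|k q IH] /=; last exact: word_span_gen.
have -> : v' = (p`!%:R)^-1 *: iter p (E i j) v.
  by rewrite extremal_vec_raise scalerA mulVf ?factK_neq0 ?scale1r.
by apply/word_spanZ/word_span_iter/word_span_nil.
Qed.

(** [f_j v = 0] since the weight of [v] takes the value [- p] on [h_j]. *)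
Lemma demazure_f x : demazure v x -> demazure v (F i j x).
Proof.
have [_ wv] := extremal_vec_weight desc'.
apply: (e_word_span_stable_f wv); apply: (extremal_f wv).
by rewrite /= -/(weyl_act A w _) ffunE wj Adiag; lia.
Qed.

Lemma nil_expE (t : K) x : nil_exp (act (L i) (t *: chf C j)) x =
  \sum_(k < (\dim {:L i}).+1) (t ^+ k / k`!%:R) *: iter k (F i j) x.
Proof.
rewrite /nil_exp sum_lfunE; apply: eq_bigr => k _; rewrite div_powE act_scale.
rewrite mulrC -scalerA; congr (_ *: _); elim: (k : nat) => [|q IH] /=.
  by rewrite scale1r.
by rewrite IH scale_lfunE linearZ /= scalerA exprS.
Qed.

Lemma demazure_nil_exp (t : K) x : demazure v' x ->
  demazure v (nil_exp (act (L i) (t *: chf C j)) x).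
Proof.
move=> /demazure_sub sx; rewrite nil_expE; apply: word_span_sum => k _.
apply: word_spanZ; elim: (k : nat) => //= q; exact: demazure_f.
Qed.

(** For [k < p] the vector [e_j^k v] has the weight of [v'] minus
    [(p - k) alpha_j], while the weights of [U(n+) v'] are at least that of [v']. *)
Lemma form_nil_exp (t : K) x : demazure v' x ->
  fm_form (nil_exp (act (L i) (t *: chf C j)) x) v = t ^+ p * fm_form x v'.
Proof.
move=> sx; rewrite nil_expE form_suml.
have [v'0 wv'] := extremal_vec_weight desc.
have [_ wv] := extremal_vec_weight desc'.
have pd : (p < (\dim {:L i}).+1)%N.
  rewrite ltnNge; apply/negP => /ltnW dp.
  have := iter_f_neq0 Adiag wv' wj v'0.
  by rewrite (sl2_nilp_f (act_hf_diag C Adiag j) (wv' j) dp) eqxx.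
rewrite (bigD1 (Ordinal pd)) //= big1 => [|k kp].
  rewrite addr0 formZl form_iter_f extremal_vec_raise formZr mulrA.
  by rewrite divfK ?factK_neq0.
rewrite formZl form_iter_f.
have [pk|kp'|kp'] := ltngtP p k.
- by rewrite extremal_vec_raise0 // form0r mulr0.
- suff -> : fm_form x (iter k (E i j) v) = 0 by rewrite mulr0.
  elim: sx => [q|c a b _ sa _ sb]; last by rewrite formDl formZl sa sb mulr0 addr0.
  have [c wc] := weight_vec_e_word wv' q.
  apply: form_weight_neq wc (weight_vec_iter_e j k wv) _; apply/eqP.
  rewrite /= -/(weyl_act A w _) simple_reflE wj -addrA => /addrI ceq.
  pose c' q := (c q)%:Z + (q == j)%:Z * (p%:Z - k%:Z).
  have : root_comb A c' = 0.
    rewrite /c' root_combD root_combMz root_comb_delta ceq mulrzBr.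
    by rewrite addrACA addNr -pmulrn subrr addr0.
  by move/(root_comb_inj S)/(_ j); rewrite /c' eqxx; lia.
- by move: kp; rewrite -val_eqE /= kp' eqxx.
Qed.

End Step.

Definition y_word (s : seq ('I_n * K)) : Uminus S :=
  foldr (fun p x => um_mul (um_y S p.1 p.2) x) (um_one S) s.

Fixpoint monomial (l : weight n) (s : seq ('I_n * K)) : K :=
  if s is p :: s' then
    p.2 ^+ `|weyl_act A (unzip1 s') l p.1|%N * monomial l s'
  else 1.

Lemma form_y_word i (s : seq ('I_n * K)) :
  descending (fund_weight i) (unzip1 s) ->
  fm_form (y_word s i (fm_u (L i))) (extremal_vec S i (unzip1 s)) =
    monomial (fund_weight i) s.
Proof.
move=> desc.
suff [] : word_span (fun q => E i q) (extremal_vec S i (unzip1 s))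
    (y_word s i (fm_u (L i))) /\
  fm_form (y_word s i (fm_u (L i))) (extremal_vec S i (unzip1 s)) =
    monomial (fund_weight i) s by [].
elim: s desc => [_|[j t] s IH].
  by rewrite /= id_lfunE fm_form_u; split=> //; apply: word_span_nil.
move=> /= /andP[+ desc]; rewrite -/(weyl_act A _ _) => wj0.
have [p wj] : exists p : nat, weyl_act A (unzip1 s) (fund_weight i) j = p.
  by case: (weyl_act A _ _ j) wj0 => // p _; exists p.
have [sx <-] := IH desc; rewrite comp_lfunE; split.
  exact: (demazure_nil_exp desc wj).
have := form_nil_exp desc wj t sx; rewrite wj /= => <-.
by rewrite -/(weyl_act A _ _) wj.
Qed.

End Extremal.

(** * Independence of the word *)

Section Confluence.
Variables (K : numFieldType) (n : nat) (A : 'M[int]_n) (g : lieAlgebra K).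
Variables (C : chevalley A g) (V : lieModule g).
Hypothesis Adiag : forall j, A j j = 2.
Local Notation F j := (act V (chf C j)).

Fixpoint run_weight (l : weight n) (p : seq 'I_n) : weight n :=
  if p is j :: p' then run_weight (simple_refl A j l) p' else l.

Fixpoint run_vec (l : weight n) (p : seq 'I_n) (v : V) : V :=
  if p is j :: p' then
    run_vec (simple_refl A j l) p' (div_pow (F j) `|l j|%N v)
  else v.

Fixpoint strict_path (l : weight n) (p : seq 'I_n) : bool :=
  if p is j :: p' then (0 < l j) && strict_path (simple_refl A j l) p' else true.

Definition antidominant (l : weight n) := forall j, l j <= 0.

Lemma run_weight_cat l p q :
  run_weight l (p ++ q) = run_weight (run_weight l p) q.
Proof. by elim: p l => //= j p IH l. Qed.

Lemma run_vec_cat l p q v :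
  run_vec l (p ++ q) v = run_vec (run_weight l p) q (run_vec l p v).
Proof. by elim: p l v => //= j p IH l v. Qed.

Lemma strict_path_cat l p q :
  strict_path l (p ++ q) = strict_path l p && strict_path (run_weight l p) q.
Proof. by elim: p l => //= j p IH l; rewrite IH andbA. Qed.

Lemma f_commute j k : j != k -> A j k = 0 -> forall v, F j (F k v) = F k (F j v).
Proof.
move=> jk Ajk v; have := chev_serre_f C jk; rewrite Ajk subr0 /= => br.
by rewrite act_commute br act0 lfunE addr0.
Qed.

Lemma f_serre2 j k v : j != k -> A j k = -1 ->
  F j (F j (F k v)) = 2 *: F j (F k (F j v)) - F k (F j (F j v)).
Proof.
move=> jk Ajk; have := chev_serre_f C jk; rewrite Ajk /=.
set b := bracket (chf C j) (chf C k) => br.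
have bE w : act V b w = F j (F k w) - F k (F j w).
  by rewrite [F j (F k w)]act_commute addrC addKr.
have := act_commute (chf C j) b v; rewrite br act0 lfunE addr0 !bE linearB /=.
by move/eqP; rewrite subr_eq scaler_nat mulr2n => /eqP ->; rewrite addrAC.
Qed.

Lemma braid_commute j k a b v : j != k -> A j k = 0 ->
  div_pow (F k) b (div_pow (F j) a v) = div_pow (F j) a (div_pow (F k) b v).
Proof.
move=> jk Ajk.
have iterZ q p (c : K) x : iter q (F p) (c *: x) = c *: iter q (F p) x.
  by elim: q => //= q ->; rewrite linearZ.
rewrite !div_powE !iterZ !scalerA [X in X *: _]mulrC; congr (_ *: _).
have one x : F k (iter a (F j) x) = iter a (F j) (F k x).
  by elim: a => //= a <-; rewrite (f_commute jk Ajk).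
by elim: b => //= b ->; rewrite one.
Qed.

(** In type [A_2] both sides of [f_j f_k^2 f_j = f_k f_j^2 f_k] equal
    [2 f_k f_j f_k f_j - f_k^2 f_j^2]. *)
Lemma braid_A2 j k v : j != k -> A j k = -1 -> A k j = -1 ->
  div_pow (F j) 1 (div_pow (F k) 2 (div_pow (F j) 1 v)) =
  div_pow (F k) 1 (div_pow (F j) 2 (div_pow (F k) 1 v)).
Proof.
move=> jk Ajk Akj; have kj : k != j by rewrite eq_sym.
rewrite !div_powE /= !invr1 !scale1r !linearZ /=; congr (_ *: _).
have := f_serre2 (F j v) kj Akj; rewrite (f_serre2 v jk Ajk) linearB linearZ /=.
by move->; rewrite opprB addrC subrK.
Qed.

Variable P : weight n -> Prop.
Hypothesis P_refl : forall l j, P l -> P (simple_refl A j l).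
Hypothesis P_branch : forall l j k, P l -> j != k -> 0 < l j -> 0 < l k ->
  (A j k = 0 /\ A k j = 0) \/ [/\ A j k = -1, A k j = -1, l j = 1 & l k = 1].

Lemma branch_join l j k : P l -> j != k -> 0 < l j -> 0 < l k -> exists rj rk,
  [/\ strict_path (simple_refl A j l) rj /\ strict_path (simple_refl A k l) rk,
      size rj = size rk,
      run_weight l (j :: rj) = run_weight l (k :: rk)
    & forall v, run_vec l (j :: rj) v = run_vec l (k :: rk) v].
Proof.
move=> Pl jk lj lk; have [[Ajk Akj]|[Ajk Akj lj1 lk1]] := P_branch Pl jk lj lk.
  have sjk : simple_refl A j l k = l k by rewrite ffunE Akj mulr0 subr0.
  have skj : simple_refl A k l j = l j by rewrite ffunE Ajk mulr0 subr0.
  exists [:: k], [:: j]; split=> [||/=|v /=].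
  - by rewrite /= sjk skj lj lk.
  - by [].
  - rewrite [LHS]simple_reflE [RHS]simple_reflE.
    by rewrite sjk skj !simple_reflE addrAC.
  - by rewrite sjk skj braid_commute.
have s1 : simple_refl A j l k = 2 by rewrite ffunE Akj lj1 lk1.
have s2 : simple_refl A k l j = 2 by rewrite ffunE Ajk lj1 lk1.
have s1' : simple_refl A j l j = -1 by rewrite ffunE Adiag lj1.
have s2' : simple_refl A k l k = -1 by rewrite ffunE Adiag lk1.
have t1 : simple_refl A k (simple_refl A j l) j = 1.
  by rewrite ffunE s1 s1' Ajk.
have t2 : simple_refl A j (simple_refl A k l) k = 1.
  by rewrite ffunE s2 s2' Akj.
exists [:: k; j], [:: j; k]; split=> [||/=|v /=].
- by rewrite /= s1 s2 t1 t2.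
- by [].
- rewrite [LHS]simple_reflE [RHS]simple_reflE t1 t2.
  rewrite [simple_refl A k (simple_refl A j l)]simple_reflE s1.
  rewrite [simple_refl A j (simple_refl A k l)]simple_reflE s2.
  rewrite !simple_reflE lj1 lk1 !mulr1z -!pmulrn !mulr2n !opprD !addrA.
  by apply/ffunP => q; rewrite !ffunE; ring.
- by rewrite s1 s2 t1 t2 lj1 lk1 /= braid_A2.
Qed.

(** Newman's lemma for the strictly descending paths from [l]: as branchings
    close by paths of equal lengths, one path that reaches an antidominant
    weight bounds all the others. *)
Lemma confluence m l p v : P l -> strict_path l p -> size p = m ->
  antidominant (run_weight l p) -> forall q, strict_path l q ->
  exists r, [/\ strict_path (run_weight l q) r, size (q ++ r) = m,
    antidominant (run_weight l (q ++ r)) & run_vec l (q ++ r) v = run_vec l p v].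
Proof.
elim: m l p v => [|m IH] l p v Pl sp szp dp q sq.
  case: p sp szp dp => // _ _ dp; case: q sq => [|k q] /=; first by exists [::].
  by move=> /andP[]; rewrite ltNge dp.
case: p sp szp dp => //= j p /andP[lj sp] [szp] dp.
case: q sq => [_|k q /= /andP[lk sq]].
  by exists (j :: p); rewrite /= lj sp szp.
have [jk|jk] := eqVneq k j.
  subst k.
  have [r [sr szr dr vr]] :=
    IH _ p (div_pow (F j) `|l j| v) (P_refl j Pl) sp szp dp q sq.
  by exists r; rewrite /= szr; split.
rewrite eq_sym in jk.
have [rj [rk [[srj srk] sz wE vE]]] := branch_join Pl jk lj lk.
have [r [sr szr dr vr]] :=
  IH _ p (div_pow (F j) `|l j| v) (P_refl j Pl) sp szp dp rj srj.
rewrite /= in wE vE.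
have srkr : strict_path (simple_refl A k l) (rk ++ r).
  by rewrite strict_path_cat srk -wE sr.
have szrkr : size (rk ++ r) = m by rewrite -szr !size_cat sz.
have drkr : antidominant (run_weight (simple_refl A k l) (rk ++ r)).
  by rewrite run_weight_cat -wE -run_weight_cat.
have [r' [sr' szr' dr' vr']] :=
  IH _ _ (div_pow (F k) `|l k| v) (P_refl k Pl) srkr szrkr drkr q sq.
exists r'; rewrite /= szr'; split=> //.
by rewrite vr' run_vec_cat -wE -vE -run_vec_cat vr.
Qed.

End Confluence.

Section Uniqueness.
Variables (K : numFieldType) (n : nat) (A : 'M[int]_n) (S : setting K A).
Hypothesis Adiag : forall j, A j j = 2.
Variable P : weight n -> Prop.
Hypothesis P_refl : forall l j, P l -> P (simple_refl A j l).
Hypothesis P_branch : forall l j k, P l -> j != k -> 0 < l j -> 0 < l k ->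
  (A j k = 0 /\ A k j = 0) \/ [/\ A j k = -1, A k j = -1, l j = 1 & l k = 1].
Variable i : 'I_n.
Hypothesis P_fund : P (fund_weight i).
Local Notation C := (st_chev S).
Local Notation L := (st_L S).

(** The letters with exponent zero change neither the weight nor the vector, and
    are dropped. *)
Lemma extremal_vec_strict_path w : descending A (fund_weight i) w -> exists p,
  [/\ strict_path A (fund_weight i) p,
      run_weight A (fund_weight i) p = weyl_act A w (fund_weight i)
    & run_vec C (fund_weight i) p (fm_u (L i)) = extremal_vec S i w].
Proof.
elim: w => [|j w IH] /=; first by exists [::].
rewrite -/(weyl_act A w _) => /andP[wj /IH[p [sp wp vp]]].
move: wj; rewrite le_eqVlt => /orP[/eqP wj|wj].
  exists p; rewrite wp vp -wj simple_reflE -wj mulr0z subr0 div_powE.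
  by rewrite invr1 scale1r.
exists (p ++ [:: j]); rewrite strict_path_cat run_weight_cat run_vec_cat /=.
by rewrite sp wp wj vp.
Qed.

Lemma extremal_vec_unique w w' :
  descending A (fund_weight i) w -> descending A (fund_weight i) w' ->
  antidominant (weyl_act A w (fund_weight i)) ->
  antidominant (weyl_act A w' (fund_weight i)) ->
  extremal_vec S i w = extremal_vec S i w'.
Proof.
move=> /extremal_vec_strict_path[p [sp wp vp]].
move=> /extremal_vec_strict_path[q [sq wq vq]]; rewrite -wp -wq -vp -vq => dp dq.
have [[|k r] [sr _ _ <-]] :=
  confluence C Adiag P_refl P_branch (fm_u (L i)) P_fund sp erefl dp sq.
  by rewrite cats0.
by move: sr => /= /andP[]; rewrite ltNge dq.
Qed.

Theorem Fcoef_monomial (w : seq 'I_n) (s : seq ('I_n * K)) :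
  longest_word A w -> descending A (fund_weight i) (unzip1 s) ->
  antidominant (weyl_act A (unzip1 s) (fund_weight i)) ->
  Fcoef S w i (y_word S s) = monomial A (fund_weight i) s.
Proof.
move=> lw ds as_; rewrite -(form_y_word S Adiag ds) /Fcoef; congr fm_form.
apply: extremal_vec_unique => //.
  by apply: (reduced_descending S Adiag); case: lw.
by move=> j; apply: (longest_antidominant S Adiag).
Qed.

End Uniqueness.

(** * Coordinates of weights in the classical types *)

(* Decides all the equality tests between indices, identifying the indices found
   equal. *)
Ltac nat_cases := repeat (case: eqP => [?|?]; subst;
  repeat match goal with
    | H : S ?a = S ?b |- _ =>
        first [constr_eq a b; clear H | injection H as H; subst]
  end; rewrite /= ?andbF ?orbF; try lia).

(* The same for arbitrary tests, without cancelling successors. *)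
Ltac index_cases := rewrite /=;
  repeat (first [case: eqP => ? | case: ifP => ?]; subst; rewrite /=);
  try lia; try done.

Section Coordinates.
Variables (ty : dynkin) (n : nat).

(** Type [A_n] acts on [n + 1] coordinates, by permutations. *)
Definition num_coords := if ty is TypeA then n.+1 else n.

(** Twice the value on [h_j] of the weight with doubled coordinates [X], numbered
    from 1.  Doubling makes the coordinates of the spin weights integral. *)
Definition coroot_val (X : nat -> int) (j : nat) : int :=
  match ty with
  | TypeA => X j - X j.+1
  | TypeB => if j == n then 2 * X n else X j - X j.+1
  | TypeC => if j == n then X n else X j - X j.+1
  | TypeD => if j == n then X n.-1 + X n else X j - X j.+1
  end.

Definition swap_coords (j : nat) (X : nat -> int) (q : nat) : int :=
  if q == j then X j.+1 else if q == j.+1 then X j else X q.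

Definition reflect_coords (j : nat) (X : nat -> int) (q : nat) : int :=
  match ty with
  | TypeA => swap_coords j X q
  | TypeB | TypeC =>
      if j == n then if q == n then - X n else X q else swap_coords j X q
  | TypeD => if j == n then
               if q == n.-1 then - X n else if q == n then - X n.-1 else X q
             else swap_coords j X q
  end.

Hypothesis rankD : ty = TypeD -> (3 <= n)%N.

Lemma coroot_val_reflect X a b : (1 <= a <= n)%N -> (1 <= b <= n)%N ->
  coroot_val (reflect_coords a X) b =
    coroot_val X b - coroot_val X a * cartan_entry ty n b a.
Proof.
move=> an bn; move: rankD.
rewrite /coroot_val /reflect_coords /swap_coords /cartan_entry.
have [n' nE] : exists n', n = n'.+1 by case: n an => [|n'] //; [lia|exists n'].
subst n; move: an bn; rewrite /=.
by case: ty => an bn r /=; last have {}r := r erefl; nat_cases.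
Qed.

(** The doubled coordinates of the weights in the orbits of the fundamental
    weights; the second case is that of the spin weights. *)
Definition small_coords (X : nat -> int) :=
  (forall q, [\/ X q = -2, X q = 0 | X q = 2]) \/ (forall q, X q = -1 \/ X q = 1).

Lemma small_coords_reflect j X : small_coords X -> small_coords (reflect_coords j X).
Proof.
have neg3 (x : int) : [\/ x = -2, x = 0 | x = 2] -> [\/ - x = -2, - x = 0 | - x = 2].
  by case=> ->; [apply: Or33|apply: Or32|apply: Or31].
have neg2 (x : int) : x = -1 \/ x = 1 -> - x = -1 \/ - x = 1.
  by case=> ->; [right|left].
rewrite /reflect_coords /swap_coords; case=> sX; [left|right] => q; case: ty;
  repeat (case: eqP => _); auto.
Qed.

(** Two adjacent nodes are positive only on coordinates [2, 0, -2] in a row, or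
    [2, 0, 2] at the fork of type [D]; the last two nodes of types [B] and [C]
    would require [X p > X q > 0], which small coordinates exclude. *)
Lemma small_coords_branch X a b : small_coords X ->
  (1 <= a <= n)%N -> (1 <= b <= n)%N ->
  a != b -> 0 < coroot_val X a -> 0 < coroot_val X b ->
  (cartan_entry ty n a b = 0 /\ cartan_entry ty n b a = 0) \/
  [/\ cartan_entry ty n a b = -1, cartan_entry ty n b a = -1,
      coroot_val X a = 2 & coroot_val X b = 2].
Proof.
move=> sX an bn; move: rankD; rewrite /coroot_val /cartan_entry.
have [n' nE] : exists n', n = n'.+1 by case: n an => [|n'] //; [lia|exists n'].
subst n; move: an bn; rewrite /=.
have down p q r : X q < X p -> X r < X q -> [/\ X p = 2, X q = 0 & X r = -2].
  by case: sX => sX; case: (sX p) (sX q) (sX r) => -> [] -> [] ->.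
have bend p q r : X q < X p -> 0 < X q + X r -> [/\ X p = 2, X q = 0 & X r = 2].
  by case: sX => sX; case: (sX p) (sX q) (sX r) => -> [] -> [] ->.
clear sX.
case: ty => an bn r /=; last have {}r := r erefl; nat_cases;
  move=> *; match goal with
  | _ : is_true (0 < X ?p - X ?q), _ : is_true (0 < X ?q - X ?r) |- _ =>
      have [||? ? ?] := @down p q r; [lia|lia|right; split; lia]
  | _ : is_true (0 < X ?p - X ?q), _ : is_true (0 < X ?q + X ?r) |- _ =>
      have [||? ? ?] := @bend p q r; [lia|lia|right; split; lia]
  | _ : is_true (0 < X ?p - X ?q) |- _ =>
      by have [||] := @bend p q q; lia
  end.
Qed.

Definition coords_of (X : nat -> int) (l : weight n) :=
  forall j : 'I_n, 2 * l j = coroot_val X j.+1.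

Lemma coords_of_reflect X l (j : 'I_n) : coords_of X l ->
  coords_of (reflect_coords j.+1 X) (simple_refl (cartan ty n) j l).
Proof.
move=> Xl k; rewrite coroot_val_reflect ?ltn_ord // -!Xl ffunE mxE; ring.
Qed.

Definition orbit_type (l : weight n) := exists2 X, small_coords X & coords_of X l.

Lemma orbit_type_refl l (j : 'I_n) :
  orbit_type l -> orbit_type (simple_refl (cartan ty n) j l).
Proof.
case=> X sX Xl; exists (reflect_coords j.+1 X).
  exact: small_coords_reflect.
exact: coords_of_reflect.
Qed.

Lemma orbit_type_branch l (j k : 'I_n) : orbit_type l -> j != k ->
  0 < l j -> 0 < l k ->
  (cartan ty n j k = 0 /\ cartan ty n k j = 0) \/
  [/\ cartan ty n j k = -1, cartan ty n k j = -1, l j = 1 & l k = 1].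
Proof.
case=> X sX Xl jk lj lk; rewrite !mxE.
have := @small_coords_branch X j.+1 k.+1 sX (ltn_ord j) (ltn_ord k).
rewrite eqSS -!Xl => /(_ jk)[||[-> ->]|[-> -> ej ek]]; [lia|lia|by left|right].
by split=> //; lia.
Qed.

Lemma cartan_diag j : cartan ty n j j = 2.
Proof. by rewrite mxE /cartan_entry eqxx. Qed.

Definition fund_coord (i q : nat) : int :=
  let vect := if (q <= i)%N then 2 else 0 in
  match ty with
  | TypeA | TypeC => vect
  | TypeB => if i == n then 1 else vect
  | TypeD => if i == n then 1 else
             if i.+1 == n then (if q == n then -1 else 1) else vect
  end.

Lemma small_coords_fund i : small_coords (fund_coord i).
Proof.
rewrite /fund_coord; case: ty; repeat case: eqP => _;
  try (by left => q; case: ifP => _; [apply: Or33|apply: Or32]); right => q;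
  by [right | case: ifP; [left|right]].
Qed.

Lemma coords_of_fund (i : 'I_n) : coords_of (fund_coord i.+1) (fund_weight i).
Proof.
move=> j; rewrite ffunE /coroot_val /fund_coord -val_eqE /=.
have := rankD; move: (ltn_ord i) (ltn_ord j).
have [n' nE] : exists n', n = n'.+1.
  by case: n i {j} => [[]|n'] //; exists n'.
case: ty; move: (i : nat) (j : nat); rewrite nE => a b; nat_cases.
all: repeat case: ifP; lia.
Qed.

End Coordinates.

(** * Following a weight along a word *)

Section Runs.
Variables (K : numFieldType) (ty : dynkin) (m : nat).
Local Notation n := m.+1.
Local Notation num_coords := (num_coords ty n).
Local Notation coroot_val := (coroot_val ty n).
Local Notation reflect_coords := (reflect_coords ty n).

Definition agree_coords (X Y : nat -> int) :=
  forall q, (1 <= q <= num_coords)%N -> X q = Y q.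

(** The letters act from right to left, as in [weyl_act].  As the exponent [p] is a
    natural number, a derivation also certifies that all exponents are
    nonnegative.  Coordinates are compared within their range only, so that [Y] may
    be given by a formula that fails elsewhere. *)
Inductive runs (X : nat -> int) : seq (nat * K) -> (nat -> int) -> K -> Prop :=
| runs_nil Y : agree_coords Y X -> runs X [::] Y 1
| runs_cons j t s Y c p Z : runs X s Y c -> (1 <= j <= n)%N ->
    coroot_val Y j = 2 * p%:Z -> agree_coords Z (reflect_coords j Y) ->
    runs X ((j, t) :: s) Z (t ^+ p * c).

Lemma agree_trans X Y Z : agree_coords X Y -> agree_coords Y Z -> agree_coords X Z.
Proof. by move=> XY YZ q qd; rewrite XY ?YZ. Qed.

Lemma runs_agree X s Y Y' c : runs X s Y c -> agree_coords Y' Y -> runs X s Y' c.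
Proof.
case=> [Z ZX|j t s' Z c' p Z' rs jn e ZZ] YY.
  by apply: runs_nil; apply: agree_trans YY ZX.
by apply: runs_cons e _ => //; apply: agree_trans YY ZZ.
Qed.

Lemma runs_agree_l X X' s Y c : runs X s Y c -> agree_coords X X' -> runs X' s Y c.
Proof.
move=> rs XX; elim: rs => [Z ZX|j t s' Z c' p Z' _ rs jn e ZZ].
  by apply: runs_nil; apply: agree_trans ZX XX.
exact: runs_cons rs jn e ZZ.
Qed.

Lemma runs_cat X s Y c s' Z c' :
  runs X s Y c -> runs Y s' Z c' -> runs X (s' ++ s) Z (c' * c).
Proof.
move=> rs rs'; elim: rs' => [W WY|j t s1 W d p W' _ IH jn e WW] /=.
  by rewrite mul1r; apply: runs_agree rs WY.
by rewrite -mulrA; apply: runs_cons IH jn e WW.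
Qed.

Lemma runs_flatten (br : nat -> seq (nat * K)) (Xs : nat -> nat -> int) c lo hi :
  (lo <= hi)%N ->
  (forall k, (lo <= k < hi)%N -> runs (Xs k.+1) (br k) (Xs k) (c k)) ->
  runs (Xs hi) (flatten [seq br k | k <- index_iota lo hi]) (Xs lo)
    (\prod_(lo <= k < hi) c k).
Proof.
move=> /subnKC <-; move: (hi - lo)%N => d; elim: d lo => [|d IH] lo rs.
  by rewrite addn0 big_geq // /index_iota subnn; apply: runs_nil.
rewrite big_ltn; last by lia.
have -> : index_iota lo (lo + d.+1) = lo :: index_iota lo.+1 (lo.+1 + d).
  by rewrite /index_iota !addKn.
rewrite /= -addSnnS; apply: runs_cat (rs lo _); last by lia.
by apply: IH => k kd; apply: rs; lia.
Qed.

Lemma coroot_val_lt X j : (j < num_coords)%N -> coroot_val X j = X j - X j.+1.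
Proof.
by rewrite /num_coords /coroot_val; case: ty => // jn; rewrite ltn_eqF.
Qed.

Lemma reflect_coords_lt X j :
  (j < num_coords)%N -> reflect_coords j X =1 swap_coords j X.
Proof.
by rewrite /num_coords /reflect_coords => + q; case: ty => // jn; rewrite ltn_eqF.
Qed.

Lemma num_coords_le : (n <= num_coords <= n.+1)%N.
Proof. by rewrite /num_coords; case: ty; rewrite leqnn leqnSn. Qed.

Lemma runs_swap X s Y c j t p Z : runs X s Y c -> (1 <= j < num_coords)%N ->
  Y j - Y j.+1 = 2 * p%:Z -> agree_coords Z (swap_coords j Y) ->
  runs X ((j, t) :: s) Z (t ^+ p * c).
Proof.
move=> rs /andP[j1 jd] e ZY; apply: runs_cons rs _ _ _.
- by have := num_coords_le; lia.
- by rewrite coroot_val_lt.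
- by move=> q qd; rewrite reflect_coords_lt // ZY.
Qed.

(** The coordinate at position [k] is carried to position [l], past the coordinates
    in between, which move down by one. *)
Lemma runs_up X k l (t : nat -> K) p : (1 <= k <= l)%N -> (l <= num_coords)%N ->
  (forall j, (k <= j < l)%N -> X k - X j.+1 = 2 * (p j)%:Z) ->
  runs X [seq (j, t j) | j <- rev (index_iota k l)]
    (fun q => if (k <= q < l)%N then X q.+1 else if q == l then X k else X q)
    (\prod_(k <= j < l) t j ^+ p j).
Proof.
move=> /andP[k1 /subnKC <-]; elim: (l - k)%N => [|d IH] ld ex.
  rewrite addn0 big_geq // /index_iota subnn; apply: runs_nil => q qd.
  by case: ifP => [|_]; [lia | case: eqP => [->|]].
rewrite addnS big_nat_recr /=; last by lia.
have -> : rev (index_iota k (k + d).+1) = (k + d)%N :: rev (index_iota k (k + d)).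
  by rewrite /index_iota -addnS !addKn -addn1 iotaD rev_cat.
rewrite mulrC; apply: runs_swap (IH _ _) _ _ _ => /=.
- by lia.
- by move=> j jk; apply: ex; lia.
- by lia.
- rewrite !ltnn andbF eqxx; case: ifP => [|_]; first by lia.
  by case: eqP => [|_]; [lia | apply: ex; lia].
- move=> q qd; rewrite /swap_coords; index_cases.
Qed.

(** The coordinate at position [l] is carried back to position [k]. *)
Lemma runs_down X k l (t : nat -> K) p : (1 <= k <= l)%N -> (l <= num_coords)%N ->
  (forall j, (k <= j < l)%N -> X j - X l = 2 * (p j)%:Z) ->
  runs X [seq (j, t j) | j <- index_iota k l]
    (fun q => if (k < q <= l)%N then X q.-1 else if q == k then X l else X q)
    (\prod_(k <= j < l) t j ^+ p j).
Proof.
move=> /andP[k1 kl] ld; move: kl => /subnKC; move: (l - k)%N => d.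
elim: d k k1 => [|d IH] k k1 kl ex.
  have lk : l = k by lia.
  rewrite lk big_geq //  /index_iota subnn; apply: runs_nil => q qd.
  by case: ifP => [|_]; [lia | case: eqP => [->|]].
rewrite big_ltn; last by lia.
have -> : index_iota k l = k :: index_iota k.+1 l.
  by rewrite /index_iota; have -> : (l - k = (l - k.+1).+1)%N by lia.
apply: runs_swap (IH k.+1 _ _ _) _ _ _ => /=.
- by lia.
- by lia.
- by move=> j jk; apply: ex; lia.
- by lia.
- rewrite ltnn eqxx; case: ifP => [|_]; first by lia.
  by case: eqP => [|_]; [lia | apply: ex; lia].
- move=> q qd; rewrite /swap_coords; index_cases.
Qed.

Hypothesis rankD : ty = TypeD -> (3 <= n)%N.

Lemma agree_coroot_val X Y j :
  agree_coords X Y -> (1 <= j <= n)%N -> coroot_val X j = coroot_val Y j.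
Proof.
rewrite /agree_coords /num_coords /coroot_val => XY jn; case: ty rankD XY => r XY /=;
  last have {}r := r erefl; repeat (case: eqP => ?); rewrite !XY //; lia.
Qed.

Lemma runs_Fcoef (S : setting K (cartan ty n)) (w : seq 'I_n) (i : nat)
    (s : seq (nat * K)) Y c :
  longest_word (cartan ty n) w -> (1 <= i <= n)%N ->
  runs (fund_coord ty n i) s Y c ->
  (forall j, (1 <= j <= n)%N -> coroot_val Y j <= 0) ->
  Fcoef S w (node m i) (y_prod S s) = c.
Proof.
move=> lw /andP[i1 in_] rs anti.
pose s' := [seq (node m p.1, p.2) | p <- s].
have -> : y_prod S s = y_word S s' by rewrite /y_prod /y_word /s' foldr_map.
have nodeE j : (1 <= j <= n)%N -> (node m j).+1 = j.
  by case: j => // j /andP[_ jn]; rewrite /node /= inordK.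
have [] : [/\ coords_of ty Y
      (weyl_act (cartan ty n) (unzip1 s') (fund_weight (node m i))),
    descending (cartan ty n) (fund_weight (node m i)) (unzip1 s')
  & monomial (cartan ty n) (fund_weight (node m i)) s' = c].
  rewrite /s' {lw anti s'}.
  elim: rs => [Z ZX|j t s1 Z d p Z' _ [IH1 IH2 <-] jn e ZZ] /=.
    split=> // j; rewrite (agree_coroot_val ZX) ?ltn_ord //.
    by have := coords_of_fund rankD (node m i); rewrite nodeE ?i1 //; apply.
  rewrite -/(weyl_act _ _ _) IH2 andbT; set l := weyl_act _ _ _ in IH1 *.
  have lj : l (node m j) = p.
    by have := IH1 (node m j); rewrite nodeE // e; lia.
  rewrite lj; split=> // q; rewrite (agree_coroot_val ZZ) ?ltn_ord //.
  by have := coords_of_reflect rankD (node m j) IH1 q; rewrite nodeE.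
move=> co de <-.
apply: (Fcoef_monomial S (@cartan_diag ty n) (@orbit_type_refl ty n rankD)
  (@orbit_type_branch ty n rankD)) => //.
- exists (fund_coord ty n (node m i).+1); first exact: small_coords_fund.
  exact: coords_of_fund.
- by move=> j; have := co j; have := anti j.+1 (ltn_ord j); lia.
Qed.

End Runs.

(** * The words of the four types *)

Section Products.
Variables (K : comNzRingType).

Lemma prod_cut lo mid hi (f g : nat -> K) : (lo <= mid <= hi)%N ->
  (forall k, (lo <= k < mid)%N -> f k = g k) ->
  (forall k, (mid <= k < hi)%N -> f k = 1) ->
  \prod_(lo <= k < hi) f k = \prod_(lo <= k < mid) g k.
Proof.
move=> /andP[lm mh] fg f1; rewrite (big_cat_nat lm mh) /=.
rewrite [X in _ * X]big_nat [X in _ * X]big1 ?mulr1; last by move=> k /f1.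
by rewrite big_nat [RHS]big_nat; apply: eq_bigr => k /fg.
Qed.

Lemma prod_drop lo mid hi (f g : nat -> K) : (lo <= mid <= hi)%N ->
  (forall k, (lo <= k < mid)%N -> f k = 1) ->
  (forall k, (mid <= k < hi)%N -> f k = g k) ->
  \prod_(lo <= k < hi) f k = \prod_(mid <= k < hi) g k.
Proof.
move=> /andP[lm mh] f1 fg; rewrite (big_cat_nat lm mh) /=.
rewrite [X in X * _]big_nat [X in X * _]big1 ?mul1r; last by move=> k /f1.
by rewrite big_nat [RHS]big_nat; apply: eq_bigr => k /fg.
Qed.

(** The row [k = i] of the triangle is empty. *)
Lemma prod_triangle i (f : nat -> nat -> K) : (0 < i)%N ->
  \prod_(1 <= k < i) \prod_(k <= j < i) f k j =
  \prod_(1 <= k < i.+1) \prod_(k <= j < i) f k j.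
Proof.
move=> i0; rewrite [RHS](@prod_cut 1 i i.+1 _ (fun k => \prod_(k <= j < i) f k j)) //.
  by rewrite i0 leqnSn.
by move=> k ki; rewrite big_geq //; lia.
Qed.

Lemma prod1 lo hi (f : nat -> K) :
  (forall k, (lo <= k < hi)%N -> f k = 1) -> \prod_(lo <= k < hi) f k = 1.
Proof. by move=> f1; rewrite big_nat big1. Qed.

End Products.

Section TypeA.
Variables (K : numFieldType) (m : nat) (a : nat -> nat -> K).
Local Notation n := m.+1.

(** The coordinates after the brackets [k], ..., [n]: these carry the coordinates
    [n], ..., [k] to the last position one after the other, so that those in the
    positions [k], ..., [n + 1] are reversed. *)
Definition stateA i k q : int :=
  if ((q < k) && (q <= i) || (k <= q) && (k + n.+1 <= i + q))%N then 2 else 0.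

Lemma runs_wordA i : (1 <= i <= n)%N ->
  runs TypeA m (fund_coord TypeA n i) (wordA n a) (stateA i 1)
    (\prod_(1 <= k < n.+1) \prod_(k <= j < n.+1)
       a k j ^+ (if ((k <= i) && (j + i <= n + k))%N then 1 else 0)).
Proof.
move=> in_; apply: (runs_agree_l (X := stateA i n.+1)); last first.
  by move=> q; rewrite /num_coords /fund_coord /stateA => qd; index_cases.
apply: runs_flatten => // k kn; apply: runs_agree.
  apply: (runs_up (l := n.+1)) => //; first by lia.
  by move=> j jk; rewrite /stateA; index_cases.
by move=> q; rewrite /num_coords /stateA => qd; index_cases.
Qed.

Lemma Fcoef_A (S : setting K (cartan TypeA n)) (w : seq 'I_n) (i : nat) :
  longest_word (cartan TypeA n) w -> (1 <= i <= n)%N ->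
  Fcoef S w (node m i) (y_prod S (wordA n a)) =
    \prod_(1 <= k < i.+1) \prod_(k <= j < (n - i + k).+1) a k j.
Proof.
move=> lw in_; rewrite (runs_Fcoef _ S lw in_ (runs_wordA in_)) //; last first.
  by move=> j jn; rewrite /coroot_val /stateA; index_cases.
apply: prod_cut => [|k ki|k ki]; first by lia.
  apply: prod_cut => [|j jk|j jk]; first by lia.
  - by case: ifP => [_|]; [rewrite expr1 | lia].
  - by case: ifP => [|_]; [lia | rewrite expr0].
by apply: prod1 => j _; case: ifP => [|_]; [lia | rewrite expr0].
Qed.

End TypeA.

Section TypesBC.
Variables (K : numFieldType) (m : nat) (a abar : nat -> nat -> K).
Local Notation n := m.+1.

(** The bracket [k] carries the coordinate [k] to the last position, changes its
    sign there and carries it back. *)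
Definition stateBC (X : nat -> int) k q := if (k <= q)%N then - X q else X q.

Lemma runs_bracketBC ty X k p1 p2 pn : ty = TypeB \/ ty = TypeC ->
  (1 <= k <= n)%N ->
  (forall j, (k <= j < n)%N -> X k - X j.+1 = 2 * (p1 j)%:Z) ->
  (forall j, (k <= j < n)%N -> X k + X j.+1 = 2 * (p2 j)%:Z) ->
  coroot_val ty n (fun => X k) n = 2 * pn%:Z ->
  runs ty m (stateBC X k.+1) (bracketBC n a abar k) (stateBC X k)
    ((\prod_(k <= j < n) a k j ^+ p1 j) *
     (a k n ^+ pn * \prod_(k <= j < n) abar k j ^+ p2 j)).
Proof.
move=> tyBC kn e1 e2 en.
have dimE : num_coords ty n = n by rewrite /num_coords; case: tyBC => ->.
have rankD : ty = TypeD -> (3 <= n)%N by case: tyBC => ->.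
have -> : bracketBC n a abar k = [seq (j, a k j) | j <- index_iota k n] ++
    (n, a k n) :: [seq (j, abar k j) | j <- rev (index_iota k n)].
  rewrite /bracketBC; have -> : index_iota k n.+1 = rcons (index_iota k n) n.
    rewrite /index_iota subSn; last by lia.
    by rewrite -addn1 iotaD cats1 subnKC; last by lia.
  by rewrite map_rcons cat_rcons.
apply: runs_agree.
  apply: runs_cat.
    apply: runs_cons.
    - apply: (@runs_up _ _ _ _ _ n _ p2); first by lia.
        by rewrite dimE.
      by move=> j jk; rewrite /stateBC ltnn ltnS; case/andP: (jk) => -> _; rewrite opprK e2.
    - by rewrite leqnn.
    - rewrite -en /coroot_val ltnn andbF eqxx /stateBC ltnn.
      by case: tyBC => ->; rewrite ?eqxx.
    - by move=> q _.
  apply: (@runs_down _ _ _ _ _ n _ p1); first by lia.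
    by rewrite dimE.
  move=> j jk; rewrite /reflect_coords /stateBC -(e1 j jk).
  have jn : (j == n) = false by lia.
  case: tyBC => ->; rewrite !eqxx jn jk ltnn andbF ltnn ltnS; case/andP: (jk) => -> _; lia.
rewrite /agree_coords dimE => q qn; rewrite /reflect_coords /stateBC.
case: q qn => // q qn /=.
case: tyBC => ->; rewrite !eqxx; index_cases.
Qed.


(** The exponents of the letters [a_{k,j}] and of the [abar_{k,j}] for the module
    [L(Lambda_i)], away from spin nodes.  For [k <= i] the bracket [k] starts with a
    coordinate [2] at position [k].  On its way up it meets [-2] before the
    position [i] (exponent 2) and [0] from there on (exponent 1); on its way back,
    now being [-2], it meets [0] down to the position [i] (exponent 1) and [-2]
    below (exponent 0). *)
Definition exp_unbarred i k j := (if (k <= i) && (i <= j) then 1 else 0)%N.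
Definition exp_barred i k j := (if k <= i then if j < i then 2 else 1 else 0)%N.

Lemma prod_exp_unbarred i k hi (f : nat -> K) : (k <= i <= hi)%N ->
  \prod_(k <= j < hi) f j ^+ exp_unbarred i k j = \prod_(i <= j < hi) f j.
Proof.
move=> ki; apply: prod_drop => // j jk; rewrite /exp_unbarred.
  by case: ifP => //; lia.
by case: ifP => //; lia.
Qed.

Lemma prod_exp_barred i k hi (f : nat -> K) : (k <= i <= hi)%N ->
  \prod_(k <= j < hi) f j ^+ exp_barred i k j =
  (\prod_(i <= j < hi) f j) * \prod_(k <= j < i) f j ^+ 2.
Proof.
move=> /andP[ki ih]; rewrite (big_cat_nat ki ih) mulrC /exp_barred ki.
by congr (_ * _); apply: eq_big_nat => j jk; case: ifP => //; lia.
Qed.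

Lemma prod_exp0 k hi (f : nat -> K) e :
  (forall j, e j = 0%N) -> \prod_(k <= j < hi) f j ^+ e j = 1.
Proof. by move=> e0; apply: prod1 => j _; rewrite e0. Qed.

Lemma runs_wordBC ty X p1 p2 pn : ty = TypeB \/ ty = TypeC ->
  (forall k j, (1 <= k <= j)%N -> (j < n)%N -> X k - X j.+1 = 2 * (p1 k j)%:Z) ->
  (forall k j, (1 <= k <= j)%N -> (j < n)%N -> X k + X j.+1 = 2 * (p2 k j)%:Z) ->
  (forall k, (1 <= k <= n)%N -> coroot_val ty n (fun => X k) n = 2 * (pn k)%:Z) ->
  runs ty m X (wordBC n a abar) (stateBC X 1)
    (\prod_(1 <= k < n.+1) ((\prod_(k <= j < n) a k j ^+ p1 k j) *
       (a k n ^+ pn k * \prod_(k <= j < n) abar k j ^+ p2 k j))).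
Proof.
move=> tyBC e1 e2 en; apply: (runs_agree_l (X := stateBC X n.+1)); last first.
  have dimE : num_coords ty n = n by rewrite /num_coords; case: tyBC => ->.
  by move=> q; rewrite dimE /stateBC => qn; case: ifP => //; lia.
apply: runs_flatten => // k kn; apply: runs_bracketBC => // [j jk|j jk|].
- by apply: e1; lia.
- by apply: e2; lia.
- by apply: en.
Qed.

Lemma Fcoef_B (S : setting K (cartan TypeB n)) (w : seq 'I_n) (i : nat) :
  longest_word (cartan TypeB n) w -> (1 <= i <= n)%N ->
  let b := fun k j => if j == n then a k n else abar k j in
  Fcoef S w (node m i) (y_prod S (wordBC n a abar)) =
    if (i < n)%N then
      (\prod_(1 <= k < i.+1) \prod_(i <= j < n.+1) (a k j * b k j))
      * \prod_(1 <= k < i) \prod_(k <= j < i) b k j ^+ 2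
    else \prod_(1 <= k < n.+1) \prod_(k <= j < n.+1) b k j.
Proof.
move=> lw in_ b; have bn k : b k n = a k n by rewrite /b eqxx.
have blt k j : (j < n)%N -> b k j = abar k j by move=> jn; rewrite /b ltn_eqF.
case: ltnP => [lin|nli]; last first.
  have ein : i = n by lia.
  have r := @runs_wordBC TypeB (fund_coord TypeB n i) (fun _ _ => 0%N)
    (fun _ _ => 1%N) (fun _ => 1%N) (or_introl erefl).
  rewrite (runs_Fcoef _ S lw in_ (r _ _ _)) //; try by rewrite /fund_coord ein eqxx.
  - apply: eq_big_nat => k kn; rewrite [RHS]big_nat_recr /=; last by lia.
    rewrite bn expr1 prod_exp0 // mul1r mulrC; congr (_ * _).
    by apply: eq_big_nat => j jk; rewrite blt ?expr1 //; lia.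
  - by move=> k kn; rewrite /coroot_val /fund_coord ein !eqxx.
  - move=> j jn; rewrite /coroot_val /stateBC /fund_coord ein !eqxx.
    by index_cases.
(* The last node doubles its coordinate in type [B]: hence the exponent 2. *)
have r := @runs_wordBC TypeB (fund_coord TypeB n i) (exp_unbarred i) (exp_barred i)
  (fun k => if (k <= i)%N then 2 else 0)%N (or_introl erefl).
have ein : (i == n) = false by lia.
rewrite (runs_Fcoef _ S lw in_ (r _ _ _)) //.
- rewrite [X in _ * X](prod_triangle (fun k j => b k j ^+ 2)); last by lia.
  rewrite -big_split /=; apply: prod_cut => [|k ki|k ki]; first by lia.
    rewrite prod_exp_unbarred ?prod_exp_barred; [|lia|lia].
    have -> : (k <= i)%N by lia.
    rewrite [X in _ = X * _]big_nat_recr /=; last by lia.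
    rewrite [X in _ = X * _ * _](_ : _ =
        \prod_(i <= j < n) a k j * \prod_(i <= j < n) abar k j); last first.
      rewrite -big_split /=; apply: eq_big_nat => j jk; rewrite blt //; lia.
    rewrite [X in _ = _ * X](_ : _ = \prod_(k <= j < i) abar k j ^+ 2); last first.
      by apply: eq_big_nat => j jk; rewrite blt //; lia.
    by rewrite bn; ring.
  have kni : (k <= i)%N = false by lia.
  by rewrite !prod_exp0 => [|j|j]; rewrite ?/exp_unbarred ?/exp_barred kni ?mulr1.
- by move=> k j kj jn; rewrite /fund_coord /exp_unbarred ein; index_cases.
- by move=> k j kj jn; rewrite /fund_coord /exp_barred ein; index_cases.
- by move=> k kn; rewrite /coroot_val /fund_coord ein eqxx; index_cases.
- move=> j jn; rewrite /coroot_val /stateBC /fund_coord ein.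
  by index_cases.
Qed.

Lemma Fcoef_C (S : setting K (cartan TypeC n)) (w : seq 'I_n) (i : nat) :
  longest_word (cartan TypeC n) w -> (1 <= i <= n)%N ->
  Fcoef S w (node m i) (y_prod S (wordBC n a abar)) =
    (\prod_(1 <= k < i.+1) \prod_(i <= j < n.+1) a k j)
    * (\prod_(1 <= k < i.+1) \prod_(i <= j < n) abar k j)
    * \prod_(1 <= k < i) \prod_(k <= j < i) abar k j ^+ 2.
Proof.
move=> lw in_.
have r := @runs_wordBC TypeC (fund_coord TypeC n i) (exp_unbarred i) (exp_barred i)
  (fun k => if (k <= i)%N then 1 else 0)%N (or_intror erefl).
rewrite (runs_Fcoef _ S lw in_ (r _ _ _)) //.
- rewrite [X in _ * X](prod_triangle (fun k j => abar k j ^+ 2)); last by lia.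
  rewrite -!big_split /=; apply: prod_cut => [|k ki|k ki]; first by lia.
    rewrite prod_exp_unbarred ?prod_exp_barred; [|lia|lia].
    have -> : (k <= i)%N by lia.
    rewrite [X in _ = X * _ * _]big_nat_recr /=; last by lia.
    by ring.
  have kni : (k <= i)%N = false by lia.
  by rewrite !prod_exp0 => [|j|j]; rewrite ?/exp_unbarred ?/exp_barred kni ?mulr1.
- by move=> k j kj jn; rewrite /fund_coord /exp_unbarred; index_cases.
- by move=> k j kj jn; rewrite /fund_coord /exp_barred; index_cases.
- by move=> k kn; rewrite /coroot_val /fund_coord eqxx; index_cases.
- move=> j jn; rewrite /coroot_val /stateBC /fund_coord.
  by index_cases.
Qed.

End TypesBC.

(* Removes the conditionals whose condition is decided by the context. *)
Ltac decide_ifs := repeat match goal with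
  | |- context [if ?b then _ else _] =>
      first [rewrite (_ : b = true); [|lia] | rewrite (_ : b = false); [|lia]]
  end.

Section TypeD.
Variables (K : numFieldType) (m : nat) (a abar : nat -> nat -> K).
Local Notation n := m.+1.

(** The last node of the fork exchanges the last two coordinates and changes both
    signs, so each bracket also changes the sign of the last coordinate. *)
Definition stateD (X : nat -> int) k q :=
  if q == n then if odd (n - k) then - X n else X n
  else if (k <= q)%N then - X q else X q.

Lemma runs_bracketD X k p1 p2 pn pl : (1 <= k < n)%N ->
  (forall j, (k <= j < m)%N -> X k - X j.+1 = 2 * (p1 j)%:Z) ->
  (forall j, (k <= j < m)%N -> X k + X j.+1 = 2 * (p2 j)%:Z) ->
  X k + stateD X k.+1 n = 2 * pn%:Z ->
  X k - stateD X k.+1 n = 2 * pl%:Z ->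
  runs TypeD m (stateD X k.+1) (bracketD n a abar k) (stateD X k)
    ((\prod_(k <= j < m) a k j ^+ p1 j * a k m ^+ pl) *
     (abar k m ^+ pn * \prod_(k <= j < m) abar k j ^+ p2 j)).
Proof.
move=> kn e1 e2 en el.
have odd_k : odd (n - k) = ~~ odd (n - k.+1).
  by have -> : (n - k = (n - k.+1).+1)%N by lia.
rewrite /stateD eqxx in en el.
pose p1' j := if j == m then pl else p1 j.
have p1'm : p1' m = pl by rewrite /p1' eqxx.
have p1'lt j : (j < m)%N -> p1' j = p1 j by rewrite /p1' => jm; rewrite ltn_eqF.
have -> : \prod_(k <= j < m) a k j ^+ p1 j * a k m ^+ pl =
    \prod_(k <= j < n) a k j ^+ p1' j.
  rewrite big_nat_recr /=; last by lia.
  rewrite p1'm; congr (_ * _); apply: eq_big_nat => j jk; rewrite p1'lt //; lia.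
clearbody p1'.
apply: runs_agree.
  apply: runs_cat.
    apply: runs_cons.
    - apply: (@runs_up _ _ _ _ _ m _ p2); [by lia|by rewrite /num_coords; lia|].
      by move=> j jk; rewrite -(e2 j jk) /stateD; decide_ifs; rewrite opprK.
    - by rewrite leqnn.
    - by rewrite /= -en /coroot_val /stateD; decide_ifs.
    - by move=> q _.
  apply: (@runs_down _ _ _ _ _ n _ p1'); [by lia|by rewrite /num_coords; lia|].
  move=> j jk; have [jm|jm] := eqVneq j m.
    subst j; rewrite p1'm -el /reflect_coords /stateD; decide_ifs.
    by rewrite opprK addrC.
  rewrite p1'lt -?(e1 j) ?/reflect_coords ?/stateD; [|lia..]; decide_ifs.
  by rewrite opprK addrC.
rewrite /agree_coords /num_coords => q qn; rewrite /reflect_coords /stateD odd_k.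
have [qk|kq|->] := ltngtP q k.
- by decide_ifs.
- have [->|qn'] := eqVneq q n.
    by decide_ifs; case: (odd _) => /=; rewrite ?opprK.
  by decide_ifs; rewrite prednK //; lia.
- by decide_ifs.
Qed.

Lemma runs_wordD X p1 p2 pn pl :
  (forall k j, (1 <= k <= j)%N -> (j < m)%N -> X k - X j.+1 = 2 * (p1 k j)%:Z) ->
  (forall k j, (1 <= k <= j)%N -> (j < m)%N -> X k + X j.+1 = 2 * (p2 k j)%:Z) ->
  (forall k, (1 <= k < n)%N -> X k + stateD X k.+1 n = 2 * (pn k)%:Z) ->
  (forall k, (1 <= k < n)%N -> X k - stateD X k.+1 n = 2 * (pl k)%:Z) ->
  runs TypeD m X (wordD n a abar) (stateD X 1)
    (\prod_(1 <= k < n) ((\prod_(k <= j < m) a k j ^+ p1 k j * a k m ^+ pl k) *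
       (abar k m ^+ pn k * \prod_(k <= j < m) abar k j ^+ p2 k j))).
Proof.
move=> e1 e2 en el; apply: (runs_agree_l (X := stateD X n)); last first.
  move=> q; rewrite /num_coords /stateD subnn => qn.
  by have [->|?] := eqVneq q n; [|decide_ifs].
apply: runs_flatten => // k kn; apply: runs_bracketD => // [j jk|j jk||].
- by apply: e1; lia.
- by apply: e2; lia.
- exact: en.
- exact: el.
Qed.

Hypothesis n3 : (3 <= n)%N.

Lemma Fcoef_D_vector (S : setting K (cartan TypeD n)) (w : seq 'I_n) (i : nat) :
  longest_word (cartan TypeD n) w -> (1 <= i <= n - 2)%N ->
  Fcoef S w (node m i) (y_prod S (wordD n a abar)) =
    (\prod_(1 <= k < i.+1) \prod_(i <= j < n) (a k j * abar k j))
    * \prod_(1 <= k < i) \prod_(k <= j < i) abar k j ^+ 2.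
Proof.
move=> lw in_; pose e k := (if (k <= i)%N then 1 else 0)%N.
have X0 q : fund_coord TypeD n i q = if (q <= i)%N then 2 else 0.
  by rewrite /fund_coord; decide_ifs.
have y0 k : stateD (fund_coord TypeD n i) k n = 0.
  by rewrite /stateD !X0; decide_ifs; case: ifP.
have r := @runs_wordD (fund_coord TypeD n i) (exp_unbarred i) (exp_barred i) e e.
rewrite (runs_Fcoef _ S lw _ (r _ _ _ _)) //; last first.
- by move=> j jn; rewrite /coroot_val /stateD !X0; index_cases.
- by move=> k kn; rewrite y0 X0 /e; index_cases.
- by move=> k kn; rewrite y0 X0 /e; index_cases.
- by move=> k j kj jn; rewrite !X0 /exp_barred; index_cases.
- by move=> k j kj jn; rewrite !X0 /exp_unbarred; index_cases.
- by lia.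
rewrite [X in _ * X](prod_triangle (fun k j => abar k j ^+ 2)); last by lia.
rewrite -big_split /=; apply: prod_cut => [|k ki|k ki]; first by lia.
  rewrite prod_exp_unbarred ?prod_exp_barred; [|lia|lia]; rewrite /e.
  have -> : (k <= i)%N by lia.
  rewrite [X in _ = X * _]big_nat_recr /=; last by lia.
  by rewrite [X in _ = X * _ * _]big_split /=; ring.
have kni : (k <= i)%N = false by lia.
by rewrite !prod_exp0 => [|j|j]; rewrite ?/exp_unbarred ?/exp_barred ?/e kni ?mulr1.
Qed.

(** On a half-spin module each bracket uses exactly one of the two nodes of the
    fork, according to the current sign of the last coordinate. *)
Lemma Fcoef_D_spin (S : setting K (cartan TypeD n)) (w : seq 'I_n) (i : nat) :
  longest_word (cartan TypeD n) w -> (n - 2 < i <= n)%N ->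
  Fcoef S w (node m i) (y_prod S (wordD n a abar)) =
    (\prod_(1 <= k < m) \prod_(k <= j < m) abar k j)
    * \prod_(1 <= k < n)
        (if odd (n - k) == (i == n) then abar k m else a k m).
Proof.
move=> lw in_.
have X1 q : (q < n)%N -> fund_coord TypeD n i q = 1.
  by move=> qn; rewrite /fund_coord; have [//|?] := eqVneq i n; decide_ifs.
have Xn : fund_coord TypeD n i n = if i == n then 1 else -1.
  by rewrite /fund_coord eqxx; case: eqP => // ?; decide_ifs.
pose yn k := odd (n - k) == (i == n).
have yE k : (k < n)%N ->
    stateD (fund_coord TypeD n i) k.+1 n = if yn k then 1 else -1.
  move=> kn; rewrite /stateD eqxx /yn Xn.
  have -> : (n - k = (n - k.+1).+1)%N by lia.
  by rewrite /=; case: (odd _); case: (i == n).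
have r := @runs_wordD (fund_coord TypeD n i) (fun _ _ => 0%N) (fun _ _ => 1%N)
  (fun k => yn k) (fun k => ~~ yn k).
rewrite (runs_Fcoef _ S lw _ (r _ _ _ _)) //; last first.
- move=> j jn; rewrite /coroot_val /stateD Xn eqxx.
  have [->|jn'] : j = n \/ j != n by lia.
    by decide_ifs; rewrite X1 ?(leqnn, ltnSn) //; case: (odd _); case: (i == n).
  have [jm|jm] : j = m \/ j != m by lia.
    by subst j; decide_ifs; rewrite X1 //; case: (odd _); case: (i == n).
  by decide_ifs; rewrite !X1; lia.
- by move=> k kn; rewrite yE ?X1; [case: (yn k)|lia|lia].
- by move=> k kn; rewrite yE ?X1; [case: (yn k)|lia|lia].
- by move=> k j kj jm; rewrite !X1; lia.
- by move=> k j kj jm; rewrite !X1; lia.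
- by lia.
rewrite [X in _ = X * _](prod_triangle abar); last by lia.
rewrite -big_split /=; apply: eq_big_nat => k kn; rewrite prod_exp0 // mul1r.
rewrite -/(yn k) (eq_big_nat _ _ (F2 := fun j => abar k j)); last first.
  by move=> j _; rewrite expr1.
by case: (yn k); rewrite /= expr0 expr1 ?mul1r ?mulr1 // mulrC.
Qed.

End TypeD.

Theorem proposition6p1 (R : realType) (m : nat) (a abar : nat -> nat -> R[i]) :
  let n := m.+1 in
  (forall (S : setting R[i] (cartan TypeA n)) (w : seq 'I_n) (i : nat),
     longest_word (cartan TypeA n) w -> (1 <= i <= n)%N ->
     Fcoef S w (node m i) (y_prod S (wordA n a)) =
       \prod_(1 <= k < i.+1) \prod_(k <= j < (n - i + k).+1) a k j) /\
  (forall (S : setting R[i] (cartan TypeB n)) (w : seq 'I_n) (i : nat),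
     longest_word (cartan TypeB n) w -> (1 <= i <= n)%N ->
     let b := fun k j => if j == n then a k n else abar k j in
     Fcoef S w (node m i) (y_prod S (wordBC n a abar)) =
       if (i < n)%N then
         (\prod_(1 <= k < i.+1) \prod_(i <= j < n.+1) (a k j * b k j))
         * \prod_(1 <= k < i) \prod_(k <= j < i) b k j ^+ 2
       else \prod_(1 <= k < n.+1) \prod_(k <= j < n.+1) b k j) /\
  (forall (S : setting R[i] (cartan TypeC n)) (w : seq 'I_n) (i : nat),
     longest_word (cartan TypeC n) w -> (1 <= i <= n)%N ->
     Fcoef S w (node m i) (y_prod S (wordBC n a abar)) =
       (\prod_(1 <= k < i.+1) \prod_(i <= j < n.+1) a k j)
       * (\prod_(1 <= k < i.+1) \prod_(i <= j < n) abar k j)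
       * \prod_(1 <= k < i) \prod_(k <= j < i) abar k j ^+ 2) /\
  (forall (S : setting R[i] (cartan TypeD n)) (w : seq 'I_n) (i : nat),
     (3 <= n)%N ->
     longest_word (cartan TypeD n) w -> (1 <= i <= n)%N ->
     let P := \prod_(1 <= k < n.-1) \prod_(k <= j < n.-1) abar k j in
     (* The factors with index (k, n-1): unbarred first, then barred first. *)
     let alt_a := \prod_(1 <= k < n)
       (if odd k then a k n.-1 else abar k n.-1) in
     let alt_abar := \prod_(1 <= k < n)
       (if odd k then abar k n.-1 else a k n.-1) in
     Fcoef S w (node m i) (y_prod S (wordD n a abar)) =
       if (i <= n - 2)%N then
         (\prod_(1 <= k < i.+1) \prod_(i <= j < n) (a k j * abar k j))
         * \prod_(1 <= k < i) \prod_(k <= j < i) abar k j ^+ 2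
       else if i == n.-1 then
         (if odd n then P * alt_abar else P * alt_a)
       else
         (if odd n then P * alt_a else P * alt_abar)).
Proof.
move=> n; split; [|split; [|split]] => S w i.
- exact: Fcoef_A.
- exact: Fcoef_B.
- exact: Fcoef_C.
move=> n3 lw in_ P alt_a alt_abar.
case: leqP => [il|il]; first by rewrite Fcoef_D_vector //; lia.
rewrite Fcoef_D_spin //; last by lia.
have oddB k : (k < n)%N -> odd (n - k) = odd n (+) odd k.
  by move=> kn; rewrite oddB // ltnW.
have [im|im] := eqVneq i n.-1.
  have -> : (i == m.+1) = false by lia.
  case on : (odd n); congr (P * _); apply: eq_big_nat => k kn;
    by rewrite oddB ?on; [case: (odd k)|lia].
have -> : (i == m.+1) = true by lia.
case on : (odd n); congr (P * _); apply: eq_big_nat => k kn;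
  by rewrite oddB ?on; [case: (odd k)|lia].
Qed.
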